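(* For any $\mathbf{x}\in B_1$ and any $\mathbf{y}=(\boldsymbol{\theta},\psi,\zeta)\in Y$, the evanescent plane wave $\mathrm{EW}_{\mathbf{y}}$ admits the modal expansion $$\mathrm{EW}_{\mathbf{y}}(\mathbf{x})=4\pi\sum_{\ell=0}^{\infty}i^{\ell}\sum_{m=-\ell}^{\ell}\left[\sum_{m'=-\ell}^{\ell}\overline{D_{\ell}^{m',m}(\boldsymbol{\theta},\psi)}\,\gamma_{\ell}^{m'}\,i^{-m'}P_{\ell}^{m'}\!\left(1+\frac{\zeta}{2\kappa}\right)\right]j_\ell(\kappa|\mathbf{x}|)\,Y_\ell^m(\mathbf{x}/|\mathbf{x}|).$$
   Context: Fix a real wavenumber $\kappa>0$. $B_1=\{\mathbf{x}\in\mathbb{R}^3:|\mathbf{x}|<1\}$, $\mathbb{S}^2$ is the unit sphere of $\mathbb{R}^3$, $\mathcal{I}=\{(\ell,m)\in\mathbb{Z}^2:0\le|m|\le\ell\}$. Evanescent plane waves. Let $\Theta=[0,\pi]\times[0,2\pi)$ and $Y=\Theta\times[0,2\pi)\times[0,+\infty)$. For $\boldsymbol{\theta}=(\theta_1,\theta_2)\in\Theta$, $\psi\in[0,2\pi)$, let $R_{\boldsymbol{\theta},\psi}=R_z(\theta_2)R_y(\theta_1)R_z(\psi)$ where $$R_y(\theta)=\begin{bmatrix}\cos\theta&0&\sin\theta\\0&1&0\\-\sin\theta&0&\cos\theta\end{bmatrix},\qquad R_z(\theta)=\begin{bmatrix}\cos\theta&-\sin\theta&0\\\sin\theta&\cos\theta&0\\0&0&1\end{bmatrix}.$$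 For $z\ge1$ let $\mathbf{d}_\uparrow(z)=(i\sqrt{z^2-1},0,z)\in\mathbb{C}^3$. For $\mathbf{y}=(\boldsymbol{\theta},\psi,\zeta)\in Y$ let $\mathbf{d}(\mathbf{y})=R_{\boldsymbol{\theta},\psi}\,\mathbf{d}_\uparrow(1+\zeta/2\kappa)\in\mathbb{C}^3$ and $\mathrm{EW}_{\mathbf{y}}(\mathbf{x})=e^{i\kappa\,\mathbf{d}(\mathbf{y})\cdot\mathbf{x}}$, where $\mathbf{d}\cdot\mathbf{x}=\sum_i d_ix_i$ (no conjugation). Special functions. For $0\le m\le\ell$ and $|x|\le1$, the Ferrers functions are $\mathsf{P}_\ell^m(x)=\frac{(-1)^m}{2^\ell\ell!}(1-x^2)^{m/2}\frac{d^{\ell+m}}{dx^{\ell+m}}(x^2-1)^\ell$, and $\mathsf{P}_\ell^{-m}=(-1)^m\frac{(\ell-m)!}{(\ell+m)!}\mathsf{P}_\ell^m$. The spherical harmonics are $Y_\ell^m(\theta,\varphi)=\gamma_\ell^me^{im\varphi}\mathsf{P}_\ell^m(\cos\theta)$ with $\gamma_\ell^m=\left[\frac{2\ell+1}{4\pi}\frac{(\ell-m)!}{(\ell+m)!}\right]^{1/2}$; also $Y_\ell^m(\mathbf{x}):=Y_\ell^m(\theta,\varphi)$ for $\mathbf{x}=(\sin\theta\cos\varphi,\sin\theta\sin\varphi,\cos\theta)\in\mathbb{S}^2$. The associated Legendre functions at real $z\ge1$ are, for $0\le m\le\ell$, $P_\ell^m(z)=\frac{1}{2^\ell\ell!}(z^2-1)^{m/2}\frac{d^{\ell+m}}{dz^{\ell+m}}(z^2-1)^\ell$,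 and $P_\ell^{-m}=\frac{(\ell-m)!}{(\ell+m)!}P_\ell^m$. $j_\ell(r)=\sqrt{\pi/2r}\,J_{\ell+1/2}(r)$ are the spherical Bessel functions ($J_\nu$ the Bessel functions of the first kind), extended continuously to $r=0$; products $j_\ell(\kappa|\mathbf{x}|)Y_\ell^m(\mathbf{x}/|\mathbf{x}|)$ are extended by continuity to $\mathbf{x}=0$. Wigner matrices. For $|m|,|m'|\le\ell$: $D_\ell^{m,m'}(\boldsymbol{\theta},\psi)=e^{im'\theta_2}\,d_\ell^{\,m,m'}(\theta_1)\,e^{im\psi}$, where $$d_\ell^{\,m,m'}(\theta)=\sum_{k=k_{\min}}^{k_{\max}}w_{\ell,k}^{m,m'}\left(\cos\tfrac\theta2\right)^{2(\ell-k)+m'-m}\left(\sin\tfrac\theta2\right)^{2k+m-m'},$$ $$w_{\ell,k}^{m,m'}=\frac{(-1)^k[(\ell+m)!(\ell-m)!(\ell+m')!(\ell-m')!]^{1/2}}{(\ell-m-k)!\,(\ell+m'-k)!\,(k+m-m')!\,k!},$$ $k_{\min}=\max\{0,m'-m\}$, $k_{\max}=\min\{\ell-m,\ell+m'\}$. *)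

(* Defs.v *)
From HB Require Import structures.
From mathcomp Require Import all_boot all_order all_algebra complex.
From mathcomp Require Import all_classical all_reals all_analysis.

Set Implicit Arguments.
Unset Strict Implicit.
Unset Printing Implicit Defensive.

Import Order.TTheory GRing.Theory Num.Theory numFieldNormedType.Exports.

Local Open Scope classical_set_scope.
Local Open Scope ring_scope.
Local Open Scope complex_scope.

(* The topology of R[i] is the one given by its modulus. *)
HB.instance Definition _ (R : realType) :=
  NormedModule.copy R[i] (R[i] : numFieldType)^o.

Section Definitions.
Variable R : realType.
Implicit Types (x t r z theta phi psi zeta kappa : R) (l : nat) (m : int).

Definition cexp (w : R[i]) : R[i] :=
  (expR (complex.Re w))%:C * (cos (complex.Im w) +i* sin (complex.Im w)).

(* 'cV[R]_3 carries the sup norm in the library; this is the Euclidean one. *)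
Definition enorm (v : 'cV[R]_3) : R := Num.sqrt (\sum_i v i 0 ^+ 2).

Definition B1 : set 'cV[R]_3 := [set v | enorm v < 1].

Definition vec3 (T : Type) (a b c : T) : 'cV[T]_3 :=
  \col_(i < 3) tnth [tuple a; b; c] i.

Definition Rz theta : 'M[R]_3 := \matrix_(i < 3, j < 3)
  tnth (tnth [tuple [tuple cos theta; - sin theta; 0];
                    [tuple sin theta; cos theta; 0];
                    [tuple 0; 0; 1]] i) j.

Definition Ry theta : 'M[R]_3 := \matrix_(i < 3, j < 3)
  tnth (tnth [tuple [tuple cos theta; 0; sin theta];
                    [tuple 0; 1; 0];
                    [tuple - sin theta; 0; cos theta]] i) j.

Definition Rot (th : R * R) psi : 'M[R]_3 := Rz th.2 *m Ry th.1 *m Rz psi.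

Definition Theta : set (R * R) := `[0, pi]%classic `*` `[0, 2 * pi[%classic.

(* y = (th, psi, zeta) *)
Definition Ydom : set (R * R * R * R) :=
  Theta `*` `[0, 2 * pi[%classic `*` `[0, +oo[%classic.

Definition d_up z : 'cV[R[i]]_3 :=
  vec3 ('i * (Num.sqrt (z ^+ 2 - 1))%:C) 0 z%:C.

Definition dir kappa (y : R * R * R * R) : 'cV[R[i]]_3 :=
  let: (th, psi, zeta) := y in
  map_mx (real_complex R) (Rot th psi) *m d_up (1 + zeta / (2 * kappa)).

Definition EW kappa (y : R * R * R * R) (v : 'cV[R]_3) : R[i] :=
  cexp ('i * kappa%:C * \sum_i dir kappa y i 0 * (v i 0)%:C).

(* The factorial of a nonnegative integer; it is only used at such integers. *)
Definition zfact m : R := (absz m)`!%:R.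

Definition rodrigues l (n : nat) x : R :=
  derive1n n (fun t => (t ^+ 2 - 1) ^+ l) x.

Definition ferrers_nat l (m : nat) x : R :=
  (-1) ^+ m / (2 ^+ l * l`!%:R) * (1 - x ^+ 2) `^ (m%:R / 2)
    * rodrigues l (l + m) x.

Definition ferrers l m x : R :=
  match m with
  | Posz k => ferrers_nat l k x
  | Negz n => let k := n.+1 in
      (-1) ^+ k * (zfact (l%:Z - k%:Z) / zfact (l%:Z + k%:Z))
        * ferrers_nat l k x
  end.

Definition legendre_nat l (m : nat) z : R :=
  1 / (2 ^+ l * l`!%:R) * (z ^+ 2 - 1) `^ (m%:R / 2) * rodrigues l (l + m) z.

Definition legendre l m z : R :=
  match m with
  | Posz k => legendre_nat l k z
  | Negz n => let k := n.+1 in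
      zfact (l%:Z - k%:Z) / zfact (l%:Z + k%:Z) * legendre_nat l k z
  end.

Definition gamma_lm l m : R :=
  Num.sqrt ((2 * l%:R + 1) / (4 * pi)
            * (zfact (l%:Z - m) / zfact (l%:Z + m))).

Definition Ylm l m theta phi : R[i] :=
  (gamma_lm l m)%:C * cexp ('i * (m%:~R * phi)%:C)
    * (ferrers l m (cos theta))%:C.

Definition sph_point (a : R * R) : 'cV[R]_3 :=
  vec3 (sin a.1 * cos a.2) (sin a.1 * sin a.2) (cos a.1).

(* The angles of a point of the sphere are unique except at the poles, where
   the azimuth is irrelevant because ferrers l m (+-1) = 0 for m != 0. *)
Definition Ysph l m (v : 'cV[R]_3) : R[i] :=
  let a := xget (0, 0) [set a | Theta a /\ v = sph_point a] in
  Ylm l m a.1 a.2.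

Definition Gamma (s : R) : R :=
  Rintegral (@lebesgue_measure R) `]0, +oo[%classic
    (fun t => t `^ (s - 1) * expR (- t)).

(* Bessel function of the first kind, at positive argument r. *)
Definition besselJ (nu : R) r : R :=
  limn (series (fun k : nat =>
    (-1) ^+ k / (k`!%:R * Gamma (k%:R + nu + 1))
      * (r / 2) `^ (2 * k%:R + nu))).

Definition sph_bessel_pos l r : R :=
  Num.sqrt (pi / (2 * r)) * besselJ (l%:R + 1 / 2) r.

Definition sph_bessel l r : R :=
  if r == 0 then lim (sph_bessel_pos l t @[t --> 0^'+])
  else sph_bessel_pos l r.

(* v |-> j_l(kappa |v|) Y_l^m(v / |v|), extended by continuity to v = 0. *)
Definition sph_wave kappa l m (v : 'cV[R]_3) : R[i] :=
  let f w := (sph_bessel l (kappa * enorm w))%:C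
               * Ysph l m ((enorm w)^-1 *: w) in
  if v == 0 then lim (f w @[w --> (0 : 'cV[R]_3)^']) else f v.

Definition wigner_w l m m' (k : nat) : R :=
  (-1) ^+ k
    * Num.sqrt (zfact (l%:Z + m) * zfact (l%:Z - m)
                * zfact (l%:Z + m') * zfact (l%:Z - m'))
    / (zfact (l%:Z - m - k%:Z) * zfact (l%:Z + m' - k%:Z)
       * zfact (k%:Z + m - m') * k`!%:R).

(* For |m|, |m'| <= l both bounds on k are nonnegative integers. *)
Definition wigner_d l m m' theta : R :=
  let kmin := absz (Num.max 0 (m' - m)) in
  let kmax := absz (Num.min (l%:Z - m) (l%:Z + m')) in
  \sum_(kmin <= k < kmax.+1)
    wigner_w l m m' k
      * cos (theta / 2) ^ (2 * (l%:Z - k%:Z) + m' - m)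
      * sin (theta / 2) ^ (2 * k%:Z + m - m').

Definition wigner_D l m m' (th : R * R) psi : R[i] :=
  cexp ('i * (m'%:~R * th.2)%:C) * (wigner_d l m m' th.1)%:C
    * cexp ('i * (m%:~R * psi)%:C).

(* The sum of f m over the integers m with -l <= m <= l. *)
Definition sum_sym l (f : int -> R[i]) : R[i] :=
  \sum_(j < l.*2.+1) f (j%:Z - l%:Z).

End Definitions.

(* Main.v *)
(* With Q(v)(s) = (x + iy) s^2 + 2 z s - (x - iy), the coefficients F_j(v) of
   Q(v)^l are, up to normalization, the solid harmonics of degree l and order
   j - l.  A rotation acts on Q by a Moebius substitution in s, so its action
   on the F_j is read off the coefficients of (c s + h)^j (c - h s)^(2l - j),
   which are the Wigner matrices.  By Taylor's formula the F_j of a real unit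
   vector are Ferrers functions, those of d_up are associated Legendre
   functions, and F_l(d) = 2^l P_l(d_z) whenever d.d = 1, also for complex d.
   Rotating a unit vector x to the pole turns the last identity into the
   addition theorem P_l(d.x) = sum_j (constant) F_j(d) F_j(x), so the bracketed
   sums collapse to (2l + 1) P_l(d.x) / 4 pi.  What remains is the Jacobi-Anger
   expansion e^(irw) = sum_l (2l + 1) i^l j_l(r) P_l(w) for complex w.  It
   follows from the Legendre expansion of w^n / n!: its coefficients are
   nonnegative and sum to 1 / n!, while |P_l(w)| <= (2 |w| + 1)^l, so exchanging
   the two summations costs at most a tail of the series of
   exp (r (2 |w| + 1)). *)
Require Import Defs.
From mathcomp Require Import all_boot all_order all_algebra complex.
From mathcomp Require Import all_classical all_reals all_analysis.
From mathcomp Require Import polyXY measurable_realfun ring lra zify.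
Import Order.TTheory GRing.Theory Num.Theory numFieldNormedType.Exports.
Set Implicit Arguments.
Unset Strict Implicit.
Unset Printing Implicit Defensive.
Local Open Scope classical_set_scope.
Local Open Scope ring_scope.

(** * Powers of a quadratic polynomial *)

Section Quad.
Variable F : numFieldType.
Implicit Types (a b c e x : F) (p q : {poly F}).

(** $Q(v)(s) = n(s)\cdot v$ with $n(s) = (s^2-1,\ i(s^2+1),\ 2s)$, and $n\cdot n = 0$. Powers of a
    linear form with isotropic $n$ are harmonic in $v$, which is why the coefficients in $s$ are
    solid harmonics. The obstacle is that $d$ is complex: it has no angles, and $|P_l(d\cdot x)| \le
    1$ fails. So what concerns $d$ is proved as polynomial identities in its coordinates, using
    $d\cdot d = 1$ without conjugation, and only real vectors are given angles. The addition theorem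
    is applied to [d_up] and the back-rotated $x$ rather than to $d$ and $x$. The second coordinate
    of [d_up] is $0$, so its solid harmonics of opposite orders agree up to sign and both factors
    can carry the same index. On the analytic side [Gamma], [besselJ], [cexp] and the values at the
    origin are given by integrals, limits and real functions; each is first tied to a power
    series. *)

Definition quad a b c : {poly F} := a *: 'X^2 + b *: 'X + c%:P.

Lemma coef_quadM0 a b c p : (quad a b c * p)`_0 = c * p`_0.
Proof.
by rewrite /quad !mulrDl !coefD -!scalerAl !coefZ coefCM coefXnM coefXM /=; ring.
Qed.

Lemma coef_quadM1 a b c p : (quad a b c * p)`_1 = b * p`_0 + c * p`_1.
Proof.
by rewrite /quad !mulrDl !coefD -!scalerAl !coefZ coefCM coefXnM coefXM /=; ring.
Qed.

Lemma coef_quadMSS a b c p j :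
  (quad a b c * p)`_j.+2 = a * p`_j + b * p`_j.+1 + c * p`_j.+2.
Proof.
by rewrite /quad !mulrDl !coefD -!scalerAl !coefZ coefCM coefXnM coefXM /= subn2.
Qed.

Lemma size_quadX a b c l : (size (quad a b c ^+ l) <= l.*2.+1)%N.
Proof.
have s3 : (size (quad a b c) <= 3)%N.
  rewrite /quad !(leq_trans (size_polyD _ _))// geq_max; apply/andP; split.
    rewrite (leq_trans (size_polyD _ _))// geq_max.
    by rewrite !(leq_trans (size_scale_leq _ _)) ?size_polyXn ?size_polyX.
  by rewrite (leq_trans (size_polyC_leq1 _)).
rewrite (leq_trans (size_poly_exp_leq _ _))//.
rewrite -muln2 mulnC ltnS leq_mul//.
by move: s3; case: (size _).
Qed.

(** Reversing the $2l+1$ coefficients is the substitution $s \mapsto 1/s$, which exchanges the outer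
    coefficients of the quadratic. *)
Lemma coef_quad_rev a b c l j : (j <= l.*2)%N ->
  (quad a b c ^+ l)`_(l.*2 - j) = (quad c b a ^+ l)`_j.
Proof.
have out (l0 : nat) a0 b0 c0 k : (l0.*2 < k)%N -> (quad a0 b0 c0 ^+ l0)`_k = 0.
  by move=> lk; rewrite nth_default// (leq_trans (size_quadX _ _ _ _)).
elim: l j => [|l IH] j jl.
  by move: jl; rewrite double0 leqn0 => /eqP ->; rewrite !expr0.
(* The indices $2l+2$, $2l+1$, $0$ and $1$ touch an end of the coefficient list, where
   [coef_quadMSS] does not apply on both sides. *)
have [jl2|jl2] := eqVneq j l.*2.+2.
  rewrite jl2 doubleS subnn !exprS coef_quadMSS coef_quadM0.
  by rewrite (out _ _ _ _ l.*2.+1)// (out _ _ _ _ l.*2.+2)// -IH// subnn; ring.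
have [jl1|jl1] := eqVneq j l.*2.+1.
  rewrite jl1 doubleS subSn// subnn !exprS.
  case: l IH {jl jl1 jl2 j} out => [|l] IH out.
    by rewrite !expr0 double0 !coef_quadM1 !coef1 /=; ring.
  rewrite doubleS coef_quadMSS coef_quadM1 (out l.+1 _ _ _ l.*2.+3)//.
  have := IH l.*2.+2; have := IH l.*2.+1; rewrite doubleS subnn subSn// subnn.
  by move=> <-// <-//; ring.
case: j jl jl1 jl2 => [|[|j]] jl jl1 jl2.
- rewrite subn0 doubleS !exprS coef_quadMSS coef_quadM0.
  by rewrite (out _ _ _ _ l.*2.+1)// (out _ _ _ _ l.*2.+2)// -IH// subn0; ring.
- rewrite doubleS subn1 /= !exprS.
  case: l IH {jl jl1 jl2} out => [|l] IH out.
    by rewrite !expr0 double0 !coef_quadM1 !coef1 /=; ring.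
  rewrite doubleS coef_quadMSS coef_quadM1 (out l.+1 _ _ _ l.*2.+3)//.
  have := IH 0%N; have := IH 1%N; rewrite doubleS subn0 subn1 /=.
  by move=> <-// <-//; ring.
have [i ji] : exists i, (l.*2 = j + i.+2)%N by exists (l.*2 - j - 2)%N; lia.
rewrite doubleS !subSS !exprS coef_quadMSS.
have [e0 [e1 e2]] : (l.*2 - j = i.+2 /\ l.*2 - j.+1 = i.+1 /\ l.*2 - j.+2 = i)%N by lia.
have [l0 [l1 l2]] : (j <= l.*2 /\ j.+1 <= l.*2 /\ j.+2 <= l.*2)%N by lia.
have := IH _ l0; have := IH _ l1; have := IH _ l2; rewrite e0 e1 e2.
by rewrite coef_quadMSS => <- <- <-; ring.
Qed.

Lemma coef_quad_scale e a b c l j :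
  (quad (e ^+ 2 * a) (e * b) c ^+ l)`_j = e ^+ j * (quad a b c ^+ l)`_j.
Proof.
elim: l j => [|l IH] j.
  rewrite !expr0 !coef1; case: j => [|j]; first by rewrite expr0 mul1r.
  by rewrite mulr0.
rewrite [quad (_ * _) _ _ ^+ _]exprS [quad a b c ^+ _]exprS; case: j => [|[|j]].
- by rewrite !coef_quadM0 IH; ring.
- by rewrite !coef_quadM1 !IH; ring.
- by rewrite !coef_quadMSS !IH !exprS; ring.
Qed.

Lemma coef_quadZ e a b c l j :
  (quad (e * a) (e * b) (e * c) ^+ l)`_j = e ^+ l * (quad a b c ^+ l)`_j.
Proof.
rewrite (_ : quad (e * a) (e * b) (e * c) = e *: quad a b c).
  by rewrite exprZn coefZ.
by rewrite /quad !scalerDr !scalerA polyCM mul_polyC.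
Qed.

(** Passing from $q(s)$ to $q(es)/e$ multiplies the outer coefficients by $e$ and $1/e$ and keeps
    the middle one. For $e$ of modulus $1$ this is a rotation about the third axis. *)
Lemma coef_quad_rot e a b c l j : e != 0 ->
  (quad (e * a) b (e^-1 * c) ^+ l)`_j = e ^+ j / e ^+ l * (quad a b c ^+ l)`_j.
Proof.
move=> e0; apply: (mulfI (expf_neq0 l e0)).
rewrite -coef_quadZ mulrA mulVKf// -expr2.
rewrite coef_quad_scale mulrA; congr (_ * _).
by rewrite mulrCA divff ?mulr1// expf_neq0.
Qed.

(** The substitution $s \mapsto -1/s$, which relates the orders $m$ and $-m$. *)
Lemma coef_quad_conj a b c l j : (j <= l.*2)%N ->
  (quad a b (- c) ^+ l)`_(l.*2 - j) = (-1) ^+ (l + j) * (quad c b (- a) ^+ l)`_j.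
Proof.
move=> jl; rewrite coef_quad_rev// exprD -mulrA -coef_quad_scale -coef_quadZ.
by congr ((quad _ _ _ ^+ _)`_ _); ring.
Qed.

Lemma coef_comp_XaddC p x n : (p \Po ('X + x%:P))`_n = (nderivn n p).[x].
Proof.
elim/poly_ind: p n => [|p k IH] n.
  by rewrite comp_poly0 coef0 linear0 horner0.
rewrite comp_polyD comp_polyM comp_polyX comp_polyC mulrDr coefD coefD coefMX coefMC coefC.
case: n => [|n]; rewrite !IH.
  by rewrite !nderivn0 !hornerE /=; ring.
rewrite [in RHS](nderivnMXaddC n p k) /= !hornerE; ring.
Qed.

(** From $ac = x^2-1$ follows $a(as^2+2xs+c) = (x+as)^2-1$, so up to powers of $a$ the coefficients
    are the Taylor coefficients of $(X^2-1)^l$ at $x$. *)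
Lemma coef_quad_nderiv a c x l m : a * c = x ^+ 2 - 1 ->
  (quad a (2 * x) c ^+ l)`_(l + m) = a ^+ m * (nderivn (l + m) (('X^2 - 1) ^+ l)).[x].
Proof.
move=> acx.
have E1 : (quad 1 (2 * x) (a * c) ^+ l)`_(l + m) = (nderivn (l + m) (('X^2 - 1) ^+ l)).[x].
  rewrite -coef_comp_XaddC rmorphXn /=.
  rewrite (_ : quad _ _ _ = ('X^2 - 1) \Po ('X + x%:P))//.
  rewrite acx /quad comp_polyB comp_polyC comp_Xn_poly scale1r -mul_polyC.
  by rewrite polyCB polyCM polyC_exp (_ : (2 : F)%:P = 2) ?rmorph_nat//; ring.
rewrite -E1.
(* Cancelling $a^l$ excludes $a = 0$, which does occur: at the poles of the sphere and at $z = 1$.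
   Then $x^2 = 1$ and the quadratic degenerates to $2xs+c$. *)
have [a0|a0] := eqVneq a 0; last first.
  apply: (mulfI (expf_neq0 l a0)).
  rewrite -coef_quadZ [RHS]mulrA -exprD -coef_quad_scale.
  by congr ((quad _ _ _ ^+ _)`_ _); ring.
have out (q : {poly F}) k : (size q <= 2)%N -> (q ^+ l)`_(l + k.+1) = 0.
  move=> sq; rewrite nth_default// (leq_trans (size_poly_exp_leq _ _))//.
  by move: sq; case: (size q) => [|[|[]]]//= _; lia.
have slin (u v : F) : (size (u *: 'X + v%:P)%R <= 2)%N.
  rewrite (leq_trans (size_polyD _ _))// geq_max (leq_trans (size_polyC_leq1 _))// andbT.
  by rewrite (leq_trans (size_scale_leq _ _)) ?size_polyX.
have lead (u v : F) : ((u *: 'X + v%:P) ^+ l)`_l = u ^+ l.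
  elim: l {E1 out} => [|k IH]; first by rewrite !expr0 coef1.
  rewrite !exprS mulrDl coefD -scalerAl coefZ coefXM coefCM /= IH.
  rewrite [X in v * X]nth_default ?mulr0 ?addr0//.
  rewrite (leq_trans (size_poly_exp_leq _ _))// ltnS.
  by move: (slin u v); case: (size _) => [|[|[]]]//= _; rewrite ?mul0n ?mul1n.
rewrite a0 mul0r /quad scale0r add0r scale1r addr0.
case: m {E1} out => [|m] out.
  rewrite addn0 expr0 mul1r lead.
  rewrite (_ : 'X^2 + (2 * x) *: 'X = 'X * ('X + (2 * x)%:P)); last first.
    by rewrite -mul_polyC; ring.
  by rewrite [in RHS]exprMn coefXnM subnn ltnn -horner_coef0 !hornerE.
by rewrite out ?expr0n ?mul0r.
Qed.
End Quad.

(** * Moebius substitutions on binary forms *)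

Section Hom.
Variable F : numFieldType.
Implicit Types (a b c e h x : F) (p q u v : {poly F}).

(** This is $v^n p(u/v)$ with denominators cleared, for $p$ of degree at most $n$. *)
Definition homog n u v p : {poly F} :=
  \sum_(j < n.+1) p`_j *: (u ^+ j * v ^+ (n - j)).

Lemma homog_sum n u v (I : finType) (f : I -> {poly F}) :
  homog n u v (\sum_i f i) = \sum_i homog n u v (f i).
Proof.
rewrite /homog exchange_big /=; apply: eq_bigr => j _.
by rewrite coef_sum scaler_suml.
Qed.

Lemma homogZXn n u v e i : (i <= n)%N ->
  homog n u v (e *: 'X^i) = e *: (u ^+ i * v ^+ (n - i)).
Proof.
rewrite -ltnS => lin; rewrite /homog (bigD1 (Ordinal lin)) //= big1 => [|j].
  by rewrite coefZ coefXn eqxx mulr1 addr0.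
by rewrite -val_eqE /= coefZ coefXn => /negPf ->; rewrite mulr0 scale0r.
Qed.

Lemma homogD n u v p q : homog n u v (p + q) = homog n u v p + homog n u v q.
Proof.
by rewrite /homog -big_split; apply: eq_bigr => j _; rewrite coefD scalerDl.
Qed.

Lemma homog_quadM n u v a b c p : (size p <= n.+1)%N ->
  homog n.+2 u v (quad a b c * p) =
  (a *: u ^+ 2 + b *: (u * v) + c *: v ^+ 2) * homog n u v p.
Proof.
move=> sp; rewrite -(coefK p).
rewrite (_ : \poly_(i < size p) p`_i = \sum_(i < n.+1) p`_i *: 'X^i); last first.
  rewrite poly_def (big_ord_widen _ (fun i => p`_i *: 'X^i : {poly F}) sp).
  rewrite [RHS](bigID (fun i : 'I_ _ => (i < size p)%N)) /= [X in _ + X]big1 ?addr0//.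
  by move=> i; rewrite -leqNgt => ip; rewrite nth_default ?scale0r.
rewrite mulr_sumr !homog_sum mulr_sumr; apply: eq_bigr => -[i /= lin] _.
rewrite homogZXn//.
have -> : quad a b c * (p`_i *: 'X^i) =
  (a * p`_i) *: 'X^(i.+2) + (b * p`_i) *: 'X^(i.+1) + (c * p`_i) *: 'X^i :> {poly F}.
  by rewrite /quad -!mul_polyC !polyCM !exprS; ring.
rewrite !homogD !homogZXn; [|lia..].
rewrite (_ : n.+2 - i.+2 = n - i)%N; last by lia.
rewrite (_ : n.+2 - i.+1 = (n - i).+1)%N; last by lia.
rewrite (_ : n.+2 - i = (n - i).+2)%N; last by lia.
by rewrite -!mul_polyC !polyCM !exprS; ring.
Qed.

Lemma homog_quadX l u v a b c :
  (a *: u ^+ 2 + b *: (u * v) + c *: v ^+ 2) ^+ l =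
  homog l.*2 u v (quad a b c ^+ l).
Proof.
elim: l => [|l IH].
  by rewrite !expr0 /homog big_ord1 coef1 scale1r mul1r.
by rewrite [LHS]exprS [quad _ _ _ ^+ _]exprS doubleS homog_quadM ?size_quadX// IH.
Qed.

(* The action on binary forms of degree [n] of the rotation whose half-angle has
   cosine [c] and sine [h]. *)
Definition rot_coef c h n j i : F :=
  ((c *: 'X + h%:P) ^+ j * (c%:P - h *: 'X) ^+ (n - j))`_i.

(** The base on the left is [quad a b c] at $(es+h)/(e-hs)$, multiplied by $(e-hs)^2$. *)
Lemma coef_quad_rot_y l a b c e h i :
  (quad (a * e ^+ 2 - b * e * h + c * h ^+ 2)
        (2 * a * e * h + b * (e ^+ 2 - h ^+ 2) - 2 * c * e * h)
        (a * h ^+ 2 + b * e * h + c * e ^+ 2) ^+ l)`_i =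
  \sum_(j < l.*2.+1) (quad a b c ^+ l)`_j * rot_coef e h l.*2 j i.
Proof.
set Q := quad _ _ _.
have -> : Q = a *: (e *: 'X + h%:P) ^+ 2 +
     b *: ((e *: 'X + h%:P) * (e%:P - h *: 'X)) + c *: (e%:P - h *: 'X) ^+ 2.
  by rewrite /Q /quad -!mul_polyC; ring.
rewrite homog_quadX /homog coef_sum.
by apply: eq_bigr => j _; rewrite coefZ.
Qed.

Lemma coef_linX (K : comNzRingType) (a b : K) n j :
  ((a%:P + b%:P * 'X) ^+ n)`_j = a ^+ (n - j) * b ^+ j *+ 'C(n, j).
Proof.
rewrite exprDn coef_sum.
have [jn|jn] := ltnP j n.+1; last first.
  rewrite bin_small// mulr0n big1// => i _.
  rewrite exprMn -!polyC_exp mulrA -polyCM -mulrnAl -polyCMn coefCM coefXn.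
  by rewrite gtn_eqF ?mulr0// (leq_trans (ltn_ord i)).
rewrite (bigD1 (Ordinal jn))//= big1 => [|i].
  rewrite exprMn -!polyC_exp mulrA -polyCM -mulrnAl -polyCMn coefCM coefXn.
  by rewrite eqxx mulr1 addr0.
rewrite -val_eqE /= => /negPf ij.
rewrite exprMn -!polyC_exp mulrA -polyCM -mulrnAl -polyCMn coefCM coefXn.
by rewrite eq_sym ij mulr0.
Qed.

(* Both sides are the coefficient of [X ^ i * Y ^ j] in
   [(c - h X + Y (c X + h)) ^ n = (c + h Y + X (c Y - h)) ^ n]. *)
Lemma rot_coef_dual c h n i j :
  'C(n, j)%:R * rot_coef c h n j i = 'C(n, i)%:R * rot_coef c (- h) n i j.
Proof.
have K (d k : F) m r s : 'C(m, r)%:R * rot_coef d k m r s =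
    (((d%:P - k *: 'X)%:P + (d *: 'X + k%:P)%:P * 'X) ^+ m)`_r`_s.
  by rewrite coef_linX coefMn [LHS]mulr_natl /rot_coef (mulrC (_ ^+ r)).
rewrite !K -coef_swapXY rmorphXn /= rmorphD rmorphM /= !swapXY_polyC swapXY_X.
suff -> : (c%:P - h *: 'X) ^:P + (c *: 'X + h%:P) ^:P * ('X)%:P =
  (c%:P - - h *: 'X)%:P + (c *: 'X + (- h)%:P)%:P * 'X :> {poly {poly F}} by [].
rewrite -!mul_polyC !(rmorphN, rmorphD, rmorphM) /= !map_polyX !map_polyC /=.
ring.
Qed.

End Hom.

(** * Legendre polynomials *)

Section Legendre.
Variable F : numFieldType.
Implicit Types (w : F).

Definition legendre_poly l : {poly F} :=
  (2 ^+ l * l`!%:R)^-1 *: ((('X^2 - 1) ^+ l)^`(l)).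

Lemma legendre_poly0 : legendre_poly 0 = 1.
Proof. by rewrite /legendre_poly !expr0 derivn0 mul1r invr1 scale1r. Qed.

Lemma legendre_poly1 : legendre_poly 1 = 'X.
Proof.
rewrite /legendre_poly !expr1 derivn1 !poly.derivE subr0 /= mulr1.
by rewrite -['X^1 *+ 2]scaler_nat scalerA mulVf ?scale1r// pnatr_eq0.
Qed.

Lemma natf_neq0 n : (n.+1)%:R != 0 :> F.
Proof. by rewrite pnatr_eq0. Qed.

(** Bonnet's recurrence. With $u = X^2-1$, differentiating $u^{l+2}$ once ([E1]) or twice ([E2])
    before applying Leibniz gives two formulas for its derivative of order $l+2$; the auxiliary $q$
    is eliminated between them. *)
Lemma legendre_poly_rec l :
  l.+2%:R *: legendre_poly l.+2 =
  (l.*2 + 3)%:R *: ('X * legendre_poly l.+1) - l.+1%:R *: legendre_poly l.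
Proof.
pose u : {poly F} := 'X^2 - 1.
have du : u^`() = 2%:R * 'X by rewrite /u !poly.derivE subr0 /= mulr_natl.
have dX n : (u ^+ n.+1)^`() = (2 * n.+1)%:R * (u ^+ n * 'X).
  by rewrite deriv_exp du /= -mulr_natl natrM; ring.
pose p k := (u ^+ k)^`(k).
pose q := (u ^+ l.+1)^`(l).
have nat_der (k n : nat) (r : {poly F}) : (k%:R * r)^`(n) = k%:R * r^`(n).
  by rewrite !mulr_natl derivnMn.
have DX n (r : {poly F}) : (r * 'X)^`(n.+1) = r^`(n) *+ n.+1 + r^`(n.+1) * 'X.
  by rewrite -[r * 'X]addr0 -polyC0 derivnMXaddC.
have E1 : p l.+2 = (2 * l.+2)%:R * (p l.+1 * 'X + l.+1%:R * q).
  by rewrite /p /q derivSn dX nat_der DX [in RHS]addrC [l.+1%:R * _]mulr_natl.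
have E2 : p l.+2 = (2 * l.+2 * (l.*2 + 3))%:R * q + (4 * l.+1 * l.+2)%:R * p l.
  rewrite /p /q !derivSn dX derivM (_ : ((2 * l.+2)%:R : {poly F})^`() = 0); last first.
    by rewrite -polyC_natr derivC.
  rewrite mul0r add0r derivM derivX mulr1 dX.
  rewrite -!nat_der -derivnD; congr (_^`(l)).
  rewrite (_ : (2 * l.+1)%:R * (u ^+ l * 'X) * 'X = (2 * l.+1)%:R * (u ^+ l * (u + 1))); last
      first.
    by rewrite (_ : u + 1 = 'X * 'X) ?mulrA// /u subrK expr2.
  rewrite [u ^+ l.+1]exprS -!mul2n; ring.
rewrite /legendre_poly -/u -/(p l.+2) -/(p l.+1) -/(p l).
have E3 : p l.+2 = (2 * (l.*2 + 3))%:R * ('X * p l.+1) - (4 * l.+1 ^ 2)%:R * p l.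
  have l1 : (l.+2)%:R != 0 :> {poly F} by rewrite -polyC_natr polyC_eq0 natf_neq0.
  apply: (mulfI l1).
  rewrite (_ : l.+2%:R * p l.+2 = (l.*2 + 3)%:R * p l.+2 - l.+1%:R * p l.+2); last first.
    by rewrite -mul2n; ring.
  by rewrite {1}E1 E2 -mul2n; ring.
have nZ k (r : {poly F}) : k%:R * r = k%:R *: r by rewrite scaler_nat mulr_natl.
rewrite !nZ in E3; rewrite -!scalerAr E3 !scalerBr !scalerA.
have l0 k : (k`!)%:R != 0 :> F by rewrite pnatr_eq0 -lt0n fact_gt0.
have t0 : 2 != 0 :> F by rewrite pnatr_eq0.
have c1 : 1 + l%:R != 0 :> F by rewrite addrC natr1 natf_neq0.
have c2 : 2 + l%:R != 0 :> F by rewrite addrC -natrD addn2 natf_neq0.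
by congr (_ *: _ - _ *: _); rewrite !exprS !factS -?mul2n; field;
  rewrite ?l0 ?c1 ?c2 ?expf_neq0.
Qed.

Lemma horner_legendre_rec l w :
  l.+2%:R * (legendre_poly l.+2).[w] =
  (l.*2 + 3)%:R * (w * (legendre_poly l.+1).[w]) - l.+1%:R * (legendre_poly l).[w].
Proof.
by have := congr1 (fun p => p.[w]) (legendre_poly_rec l); rewrite !hornerE.
Qed.

Lemma horner_legendre1 l : (legendre_poly l).[1] = 1.
Proof.
suff : (legendre_poly l).[1] = 1 /\ (legendre_poly l.+1).[1] = 1 by case.
elim: l => [|l [IH0 IH1]]; first by rewrite legendre_poly0 legendre_poly1 !hornerE.
split=> //; apply: (mulfI (natf_neq0 l.+1)).
by rewrite horner_legendre_rec IH0 IH1 -mul2n; ring.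
Qed.

(** A crude bound, but valid at every $w$ off $[-1,1]$ too; geometric growth in $l$ is all that the
    exponential tail has to absorb. *)
Lemma norm_legendre_le l w : `|(legendre_poly l).[w]| <= (2 * `|w| + 1) ^+ l.
Proof.
set r := 2 * `|w| + 1.
have r1 : 1 <= r by rewrite lerDr mulr_ge0.
have r0 : 0 <= r by rewrite (le_trans ler01).
suff : `|(legendre_poly l).[w]| <= r ^+ l /\ `|(legendre_poly l.+1).[w]| <= r ^+ l.+1 by case.
elim: l => [|l [IH0 IH1]].
  rewrite legendre_poly0 legendre_poly1 !hornerE normr1 expr0 expr1; split=> //.
  by rewrite /r mulrDl mul1r -addrA lerDl addr_ge0.
split=> //; rewrite -(ler_pM2l (ltr0Sn F l.+1)) -{1}[l.+2%:R]normr_nat -normrM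
    horner_legendre_rec.
rewrite (le_trans (ler_normB _ _))// !normrM !normr_nat.
have A : (l.*2 + 3)%:R * (`|w| * `|(legendre_poly l.+1).[w]|) <= (l.*2 + 3)%:R * `|w| * r ^+ l.+1.
  by rewrite mulrA ler_wpM2l// mulr_ge0.
have B : l.+1%:R * `|(legendre_poly l).[w]| <= l.+1%:R * r ^+ l.+1.
  by rewrite ler_wpM2l// (le_trans IH0)// ler_weXn2l.
rewrite (le_trans (lerD A B))// [r ^+ l.+2]exprS mulrA -mulrDl ler_wpM2r ?exprn_ge0//.
(* The slack is $(l+2)(2|w|+1) - (2l+3)|w| - (l+1)$; the base $2|w|+1$ is chosen to make it
   nonnegative. *)
rewrite -subr_ge0 (_ : _ - _ = `|w| + 1); last by rewrite /r -mul2n; ring.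
by rewrite addr_ge0.
Qed.

(* The coefficient of [P_l] in the Legendre expansion of [w ^ n / n!]. *)
Definition legendre_coef n l : F :=
  if (l <= n)%N && ~~ odd (n - l) then
    let k := (n - l)./2 in
    (l.*2.+1)%:R * 2 ^+ l * (k + l)`!%:R / (k`!%:R * ((k + l).*2.+1)`!%:R)
  else 0.

Lemma legendre_coefE l k : legendre_coef (l + k.*2) l =
  (l.*2.+1)%:R * 2 ^+ l * (k + l)`!%:R / (k`!%:R * ((k + l).*2.+1)`!%:R).
Proof. by rewrite /legendre_coef leq_addr addnC addnK odd_double /= doubleK. Qed.

Lemma legendre_coef_ge0 n l : 0 <= legendre_coef n l.
Proof.
by rewrite /legendre_coef; case: ifP.
Qed.

Lemma legendre_coef_out n l : (n < l)%N -> legendre_coef n l = 0.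
Proof. by move=> nl; rewrite /legendre_coef leqNgt nl. Qed.

Lemma legendre_coef_odd n l : odd (n + l) -> legendre_coef n l = 0.
Proof.
rewrite /legendre_coef; case: leqP => //= ln; rewrite oddB// -oddD => ->.
by [].
Qed.

Lemma factr_neq0 k : k`!%:R != 0 :> F.
Proof. by rewrite pnatr_eq0 -lt0n fact_gt0. Qed.

Local Ltac ne0 := rewrite gt_eqF// ?ltr_pwDl// ?addr_ge0// ?mulr_ge0//.

(** Compares the coefficients of $P_l$ in $w \cdot w^n/n! = (n+1)\,w^{n+1}/(n+1)!$, where Bonnet's
    recurrence sends $wP_{l-1}$ and $wP_{l+1}$ to $P_l$. *)
Lemma legendre_coef_rec n l :
  n.+1%:R * legendre_coef n.+1 l =
  (if l is l'.+1 then l%:R * (legendre_coef n l' / (l'.*2.+1)%:R) else 0)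
  + l.+1%:R * (legendre_coef n l.+1 / (l.*2 + 3)%:R).
Proof.
have [od|ev] := boolP (odd (n.+1 + l)).
  rewrite !legendre_coef_odd//; last by rewrite addnS -addSn.
  case: l od => [|l] od; first by rewrite !(mul0r, mulr0) addr0.
  rewrite legendre_coef_odd ?(mul0r, mulr0, addr0)//.
  by move: od; rewrite !addnS addSn /= negbK.
have [ln|ln] := ltnP n.+1 l.
  rewrite (legendre_coef_out ln) (@legendre_coef_out n l.+1); last by lia.
  case: l {ev} ln => [|l]//; rewrite ltnS => ln.
  by rewrite legendre_coef_out ?(mul0r, mulr0, addr0).
have [k nk] : exists k, n.+1 = (l + k.*2)%N.
  exists ((n.+1 - l)./2); rewrite halfK oddB// -oddD (negPf ev) subn0 subnKC//.
rewrite nk legendre_coefE.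
(* With $n+1 = l+2k$, the neighbour $l-1$ has half-gap $k$ and $l+1$ has $k-1$; one of them
   disappears when $l = 0$ or $k = 0$. *)
case: l k nk {ev ln} => [|l] [|k] nk; first by lia.
- rewrite add0r (_ : n = 1 + k.*2)%N; last by lia.
  rewrite legendre_coefE addn1 addn0 factS doubleS !factS.
  have := factr_neq0 k; have := factr_neq0 (k.*2). rewrite -!mul2n => k1 k2. field.
  by rewrite ?k1 ?k2 ?expf_neq0 /=; do ?[apply/andP; split]; ne0.
- rewrite (_ : n = l + 0.*2)%N; last by lia.
  rewrite legendre_coefE (@legendre_coef_out _ l.+2) ?double0; last by lia.
  rewrite !addn0 !add0n !doubleS !factS fact0.
  have := factr_neq0 l; have := factr_neq0 l.*2; rewrite -!mul2n => k1 k2; rewrite exprS; field.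
  by rewrite ?k1 ?k2 ?expf_neq0 /=; do ?[apply/andP; split]; ne0.
- rewrite {1}(_ : n = l + k.+1.*2)%N; last by lia.
  rewrite (_ : n = l.+2 + k.*2)%N; last by lia.
  rewrite !legendre_coefE.
  rewrite addSn (_ : k.+1 + l.+1 = (k + l).+2)%N 1?(_ : k + l.+2 = (k + l).+2)%N; [|lia..].
  rewrite !doubleS !factS.
  have := factr_neq0 k; have := factr_neq0 (k + l); have := factr_neq0 (k+l).*2.
  rewrite -!mul2n => k1 k2 k3; rewrite !exprS; field.
  rewrite ?k1 ?k2 ?k3 ?expf_neq0 /=; do ?[apply/andP; split]; ne0; rewrite addr_ge0//.
Qed.

Lemma exprn_legendre n w :
  w ^+ n / n`!%:R = \sum_(l < n.+1) legendre_coef n l * (legendre_poly l).[w].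
Proof.
elim: n => [|n IH].
  by rewrite big_ord1 legendre_poly0 (legendre_coefE 0 0) !fact0 !expr0 hornerC !mulr1.
apply: (mulfI (natf_neq0 n)).
have -> : n.+1%:R * (w ^+ n.+1 / (n.+1)`!%:R) = w * (w ^+ n / n`!%:R).
  by rewrite factS exprS; field; rewrite factr_neq0 /=; ne0.
pose P l := (legendre_poly l).[w].
pose f l := legendre_coef n l / (l.*2.+1)%:R.
have E l : w * (legendre_coef n l * P l) =
    l.+1%:R * (f l * P l.+1) + (if l is l'.+1 then l%:R * (f l * P l') else 0).
  have -> : w * (legendre_coef n l * P l) = f l * ((l.*2.+1)%:R * (w * P l)).
    by rewrite /f; field; ne0.
  case: l => [|l].
    by rewrite /P legendre_poly0 legendre_poly1 hornerC hornerX double0; ring.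
  have := horner_legendre_rec l w; rewrite -/(P _) -/(P _) -/(P _) => Hl.
  rewrite doubleS (_ : l.*2.+3 = l.*2 + 3)%N; last by rewrite addn3.
  have -> : (l.*2 + 3)%:R * (w * P l.+1) = l.+2%:R * P l.+2 + l.+1%:R * P l.
    by rewrite Hl subrK.
  by ring.
rewrite IH !mulr_sumr; under eq_bigr do rewrite E.
rewrite big_split /=.
have fout l : (n < l)%N -> f l = 0 by move=> nl; rewrite /f legendre_coef_out// mul0r.
have -> : \sum_(i < n.+1) i.+1%:R * (f i * P i.+1) =
    \sum_(i < n.+2) (if (i : nat) is l'.+1 then i%:R * (f l' * P i) else 0).
  by rewrite [RHS]big_ord_recl add0r.
have -> : \sum_(i < n.+1) (if (i : nat) is l'.+1 then i%:R * (f i * P l') else 0) =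
    \sum_(i < n.+2) i.+1%:R * (f i.+1 * P i).
  rewrite [LHS]big_ord_recl add0r 2!big_ord_recr /=.
  by rewrite !fout// ?(mul0r, mulr0, addr0).
rewrite -big_split /=; apply: eq_bigr => i _.
rewrite [RHS]mulrA legendre_coef_rec mulrDl -/(f _) /f.
rewrite (_ : (i.+1).*2.+1 = i.*2 + 3)%N; last by rewrite doubleS addn3.
by case: (nat_of_ord i) => [|l]; rewrite -/(P _); ring.
Qed.

(** Evaluate the expansion at $w = 1$, where every $P_l$ equals $1$. *)
Lemma sum_legendre_coef n : \sum_(l < n.+1) legendre_coef n l = n`!%:R^-1.
Proof.
have := exprn_legendre n 1; rewrite expr1n mul1r => ->.
by apply: eq_bigr => l _; rewrite horner_legendre1 mulr1.
Qed.

End Legendre.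

(** * The Gamma function at half-integers *)

Section GammaHalf.
Variable R : realType.
Implicit Types (t : R) (n : nat).
Local Notation mu := (@lebesgue_measure R).

Definition gauss_primitive t : R := \int[mu]_(u in `[0, t]) gauss_fun u.

Lemma gauss_primitive0 : gauss_primitive 0 = 0.
Proof. by rewrite /gauss_primitive set_itv1 Rintegral_set1. Qed.

Lemma cvg_gauss_primitive0 : gauss_primitive t @[t --> 0^'+] --> (0 : R).
Proof.
have : {within `[0, 1], continuous gauss_primitive}.
  apply: parameterized_integral_continuous => //=.
  apply: continuous_compact_integrable => //; first exact: segment_compact.
  by apply: continuous_subspaceT; exact: continuous_gauss_fun.
by move/(continuous_within_itvP _ ltr01) => [_ + _]; rewrite gauss_primitive0.
Qed.

Lemma is_derive_gauss_primitive t : 0 < t ->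
  is_derive t 1 gauss_primitive (gauss_fun t).
Proof.
move=> t0.
have [] : derivable gauss_primitive t 1 /\ gauss_primitive^`()%classic t = gauss_fun t.
  apply: (@continuous_FTC1 R gauss_fun (BLeft 0) _ (t + 1) _ _ _ _).
  - by rewrite ltrDl.
  - apply: continuous_compact_integrable => //; first exact: segment_compact.
    by apply: continuous_subspaceT; exact: continuous_gauss_fun.
  - by rewrite /=; rewrite lte_fin.
  - by move=> ?; exact: continuous_gauss_fun.
by move=> d e; apply: (DeriveDef d); rewrite -derive1E.
Qed.

Lemma cvg_gauss_primitivey : gauss_primitive t @[t --> +oo] --> Num.sqrt pi / 2.
Proof.
have : Num.sqrt (gauss_primitive t ^+ 2) @[t --> +oo] --> Num.sqrt (pi / 4).
  apply: continuous_cvg => //; first exact: sqrt_continuous.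
  exact: gauss_integral_proof.cvg_integral0_gauss_sqr.
rewrite sqrtrM ?pi_ge0// sqrtrV// (_ : 4 = 2 ^+ 2); last by rewrite expr2 -natrM.
rewrite sqrtr_sqr ger0_norm//.
rewrite (_ : (fun _ => Num.sqrt _) = gauss_primitive)//.
apply/funext => r; rewrite sqrtr_sqr// ger0_norm//.
exact: gauss_integral_proof.integral0_gauss_ge0.
Qed.

(* The primitive of [t ^ (n - 1/2) e ^ (-t)] that vanishes at [0]. *)
Fixpoint gamma_primitive n t : R :=
  if n is m.+1 then (m%:R + 2^-1) * gamma_primitive m t - t `^ (m%:R + 2^-1) * expR (- t)
  else 2 * gauss_primitive (t `^ 2^-1).

Lemma is_derive_expRN t : is_derive t 1 (fun u : R => expR (- u)) (- expR (- t)).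
Proof.
rewrite -mulrN1; exact: (is_derive1_comp (is_derive_expR _) (is_deriveNid _ _)).
Qed.

(** The base case is the substitution $u = \sqrt t$ in the Gaussian integral, the inductive step an
    integration by parts. *)
Lemma is_derive_gamma_primitive n t : 0 < t ->
  is_derive t 1 (gamma_primitive n) (t `^ (n%:R - 2^-1) * expR (- t)).
Proof.
move=> t0; elim: n => [|n IH].
  have st0 : 0 < t `^ 2^-1 by rewrite powR_gt0.
  have d1 := is_derive_gauss_primitive st0.
  have d2 := is_derive1_powR 2^-1 t0.
  have d3 := @is_derive1_comp R gauss_primitive (fun u => u `^ 2^-1) t _ _ d1 d2.
  have := is_deriveZ 2 d3.
  rewrite (_ : 2 *: _ = t `^ (0%:R - 2^-1) * expR (- t))//.
  rewrite /gauss_fun -powR_mulrn ?powR_ge0// -powRrM mulVf// powRr1 ?ltW//.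
  rewrite (_ : 2^-1 - 1 = 0%:R - 2^-1 :> R); last by field.
  by rewrite /GRing.scale /=; field.
have dp := is_derive1_powR (n%:R + 2^-1) t0.
have dm := is_deriveM dp (is_derive_expRN t).
have := is_deriveB (is_deriveZ (n%:R + 2^-1) IH) dm.
move=> d; refine (is_derive_eq d _).
rewrite /GRing.scale /= (_ : n%:R + 2^-1 - 1 = n%:R - 2^-1 :> R); last by field.
rewrite (_ : n.+1%:R - 2^-1 = n%:R + 2^-1 :> R); last by rewrite -natr1; field.
by ring.
Qed.

Lemma gamma_primitive0 n : gamma_primitive n 0 = 0.
Proof.
elim: n => [|n IH] /=; first by rewrite powR0 ?gauss_primitive0 ?mulr0.
by rewrite IH mulr0 powR0 ?mul0r ?subrr// gt_eqF// ltr_wpDl.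
Qed.

Lemma cvg_gamma_primitive0 n : gamma_primitive n t @[t --> 0^'+] --> (0 : R).
Proof.
elim: n => [|n IH] /=.
  rewrite -[X in _ --> X](mulr0 (2 : R)); apply: cvgMr => //.
  apply: (@increasing_cvg_at_right_comp R (fun u => u `^ 2^-1) gauss_primitive 0 +oo%O).
  - by [].
  - move=> x y; rewrite !in_itv/= !andbT => x0 y0 xy.
    by apply: gt0_ltr_powR => //; rewrite nnegrE.
  - by rewrite powR0//; apply: powR_cvg0.
  - by rewrite powR0//; exact: cvg_gauss_primitive0.
rewrite -[X in _ --> X](subrr (0 : R)); apply: cvgB.
  by rewrite -[X in _ --> X](mulr0 (n%:R + 2^-1 : R)); apply: cvgMr.
rewrite -[X in _ --> X](mul0r (expR (- 0) : R)); apply: cvgM.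
  by apply: powR_cvg0; rewrite ltr_wpDl.
apply: cvg_at_right_filter; apply: continuous_comp; last exact: continuous_expR.
exact: opp_continuous.
Qed.

Lemma cvg_invr_pinfty : t^-1 @[t --> +oo] --> (0 : R).
Proof.
apply/cvgrPdist_le => e e0; near=> t.
rewrite sub0r normrN ger0_norm ?invr_ge0; last by near: t; exact: nbhs_pinfty_ge.
rewrite -[leRHS]invrK lef_pV2 ?posrE ?invr_gt0//.
Unshelve. all: by end_near. Qed.

(** The bound $e^t \ge t^{n+1}/(n+1)!$ has one power more than $t^a$ needs, leaving a majorant
    proportional to $1/t$. *)
Lemma cvg_powR_expRNy (a : R) n : a <= n%:R ->
  t `^ a * expR (- t) @[t --> +oo] --> (0 : R).
Proof.
move=> an.
apply: (@squeeze_cvgr _ _ _ _ (cst 0) (fun t : R => (n.+1)`!%:R * t^-1)).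
- near=> t.
  have t1 : 1 <= t by near: t; exact: nbhs_pinfty_ge.
  have t0 : 0 < t by rewrite (lt_le_trans ltr01).
  rewrite mulr_ge0 ?powR_ge0 ?expR_ge0//= expRN.
  rewrite ler_pdivrMr ?expR_gt0// mulrAC ler_pdivlMr//.
  have := expR_ge1Dxn n (ltW t0); rewrite -lerBrDl => H.
  have {}H : t ^+ n.+1 <= (n.+1)`!%:R * expR t.
    rewrite -ler_pdivrMl ?ltr0n ?fact_gt0// mulrC.
    by rewrite (le_trans H)// lerBlDl lerDr.
  apply: le_trans H; rewrite exprSr; apply: ler_wpM2r; first exact: ltW.
  rewrite -powR_mulrn; last exact: ltW.
  exact: ler_powR.
- exact: cvg_cst.
- rewrite -[X in _ --> X](mulr0 ((n.+1)`!%:R : R)); apply: cvgMr.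
  exact: cvg_invr_pinfty.
Unshelve. all: by end_near. Qed.

(** The values $\Gamma(n+\frac12)$ generated by $\Gamma(\frac12) = \sqrt\pi$ and $\Gamma(s+1) =
    s\Gamma(s)$. *)
Fixpoint gamma_half n : R :=
  if n is m.+1 then (m%:R + 2^-1) * gamma_half m else Num.sqrt pi.

Lemma cvg_gamma_primitivey n : gamma_primitive n t @[t --> +oo] --> gamma_half n.
Proof.
elim: n => [|n IH] /=.
  rewrite -[Num.sqrt pi](@mulfVK _ 2)// mulrC; apply: cvgMr.
  apply: (cvg_comp _ _ _ cvg_gauss_primitivey).
  apply/cvgryPge => A; near=> t.
  have t0 : `|A| ^+ 2 <= t by near: t; apply: nbhs_pinfty_ge; rewrite num_real.
  rewrite (le_trans (ler_norm A))//.
  rewrite powR12_sqrt ?(le_trans _ t0)// ?sqr_ge0//.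
  by rewrite -[leLHS]normr_id -sqrtr_sqr ler_wsqrtr.
rewrite -[X in _ --> X]subr0; apply: cvgB; first exact: cvgMr.
apply: (@cvg_powR_expRNy _ n.+1).
by rewrite -[n.+1%:R]natr1 lerD2l invf_le1// ler1n.
Unshelve. all: by end_near. Qed.

(** Starting at $\Gamma(\frac32)$ keeps the exponent of $t$ positive, so the integrand is continuous
    up to $0$ and the fundamental theorem applies on $[0,\infty)$. Bessel series of order
    $l+\frac12$ use only these values. *)
Lemma Gamma_half n : Gamma (n.+1%:R + 2^-1) = gamma_half n.+1.
Proof.
pose f t := t `^ (n.+1%:R - 2^-1) * expR (- t) : R.
have n0 : 0 < n.+1%:R - 2^-1 :> R.
  by rewrite subr_gt0 (@lt_le_trans _ _ 1)// ?ler1n// invf_lt1// ltr1n.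
have cf : {in `]0, +oo[, continuous f}.
  move=> x; rewrite in_itv/= andbT => x0.
  have cp : {for x, continuous (fun u : R => u `^ (n.+1%:R - 2^-1))}.
    apply: differentiable_continuous; apply/derivable1_diffP; apply: derivable_powR.
    by rewrite in_itv/= andbT.
  apply: cvgM; first exact: cp.
  apply: continuous_comp; [exact: opp_continuous|exact: continuous_expR].
have cf0 : f x @[x --> 0^'+] --> f 0.
  rewrite /f powR0 ?gt_eqF// mul0r -[X in _ --> X](mul0r (expR (- 0) : R)).
  apply: cvgM; first exact: powR_cvg0.
  apply: cvg_at_right_filter; apply: continuous_comp; last exact: continuous_expR.
  exact: opp_continuous.
have cw : {within `[0, +oo[, continuous f} by apply/continuous_within_itvcyP.
rewrite /Gamma (_ : (fun t => _) = f); last first.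
  apply/funext => t; rewrite /f; congr (_ `^ _ * _).
  by field.
have := @Rintegral_ge0_continuous_FTC2y R f (gamma_primitive n.+1) 0 (gamma_half n.+1).
rewrite gamma_primitive0 subr0 => <-.
- rewrite /Rintegral integral_itv_obnd_cbnd//.
  apply/measurable_EFinP; apply: open_continuous_measurable_fun => //.
  by move=> x; rewrite inE; exact: cf.
- by move=> t t0; rewrite mulr_ge0 ?powR_ge0 ?expR_ge0.
- exact: cw.
- exact: cvg_gamma_primitivey.
- by move=> t t0; have [] := is_derive_gamma_primitive n.+1 t0.
- exact: cvg_gamma_primitive0.
- move=> t; rewrite in_itv/= andbT => t0; rewrite derive1E.
  by have [] := is_derive_gamma_primitive n.+1 t0.
Qed.

End GammaHalf.

(** * Power series of the spherical Bessel functions *)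

Section Bessel.
Variable R : realType.
Implicit Types (r : R) (n l k : nat).

Lemma gamma_halfE n :
  gamma_half R n = (n.*2)`!%:R / (4 ^+ n * n`!%:R) * Num.sqrt pi.
Proof.
elim: n => [|n IH] /=; first by rewrite expr0 fact0 mulr1 divr1 mul1r.
rewrite IH doubleS !factS exprS.
have := @factr_neq0 R n => k1; rewrite -!mul2n; field.
by rewrite k1 expf_neq0//= addrC natr1 pnatr_eq0.
Qed.

(* [(2 l + 1) j_l r = \sum_n bessel_coef r l n], indexed by the power of [r]. *)
Definition bessel_coef r l n : R :=
  (-1) ^+ (n - l)./2 * r ^+ n * legendre_coef R n l.

Lemma norm_bessel_coef r l n : 0 <= r -> `|bessel_coef r l n| = r ^+ n * legendre_coef R n l.
Proof.
move=> r0; rewrite /bessel_coef !normrM normrX normrN normr1 expr1n mul1r.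
by rewrite normrX !ger0_norm ?legendre_coef_ge0.
Qed.

Lemma legendre_coef_le n l : legendre_coef R n l <= n`!%:R^-1.
Proof.
have [nl|ln] := ltnP n l; first by rewrite legendre_coef_out ?invr_ge0.
rewrite -sum_legendre_coef (bigD1 (Ordinal (ln : l < n.+1)%N))//= lerDl.
by apply: sumr_ge0 => i _; exact: legendre_coef_ge0.
Qed.

Lemma norm_bessel_coef_le r l n : 0 <= r -> `|bessel_coef r l n| <= r ^+ n / n`!%:R.
Proof.
by move=> r0; rewrite norm_bessel_coef// ler_wpM2l ?exprn_ge0 ?legendre_coef_le.
Qed.

Lemma is_cvg_series_bessel_coef r l : 0 <= r -> cvgn (series (bessel_coef r l)).
Proof.
move=> r0; apply: normed_cvg.
apply: (series_le_cvg _ _ _ (is_cvg_series_exp_coeff r)) => n //=.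
- by rewrite /exp_coeff /= divr_ge0 ?exprn_ge0.
- exact: norm_bessel_coef_le.
Qed.

Lemma series_bessel_coef r l K :
  series (bessel_coef r l) (l + K.*2)%N =
  \sum_(0 <= k < K) bessel_coef r l (l + k.*2).
Proof.
elim: K => [|K IH].
  rewrite double0 addn0 big_geq// /series /= big_nat big1// => i /andP[_ il].
  by rewrite /bessel_coef legendre_coef_out ?mulr0.
rewrite doubleS !addnS !seriesSr IH big_nat_recr//=.
rewrite -addrA; congr (_ + _).
rewrite [X in _ + X](_ : _ = 0) ?addr0// /bessel_coef legendre_coef_odd ?mulr0//.
by rewrite addSn addnAC addnn /= oddD !odd_double.
Qed.

Lemma bessel_term r l k : 0 < r ->
  (l.*2.+1)%:R * Num.sqrt (pi / (2 * r)) *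
    ((-1) ^+ k / (k`!%:R * Gamma (k%:R + (l%:R + 1 / 2) + 1)) *
      (r / 2) `^ (2 * k%:R + (l%:R + 1 / 2))) = bessel_coef r l (l + k.*2).
Proof.
move=> r0; have r2 : 0 < r / 2 by rewrite divr_gt0.
rewrite (_ : k%:R + (l%:R + 1 / 2) + 1 = (k + l).+1%:R + 2^-1 :> R); last first.
  by field.
rewrite Gamma_half gamma_halfE.
rewrite (_ : 2 * k%:R + (l%:R + 1 / 2) = (l + k.*2)%:R + 2^-1 :> R); last first.
  by rewrite -mul2n; field.
rewrite powRD; last by rewrite (gt_eqF r2) implybT.
rewrite powR12_sqrt ?ltW// powR_mulrn ?ltW//.
(* The spherical normalization absorbs the half power of $r/2$; the remaining $\sqrt\pi$ cancels the
   one in [gamma_half]. *)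
have sq : Num.sqrt (pi / (2 * r)) * Num.sqrt (r / 2) = Num.sqrt pi / 2.
  rewrite -sqrtrM ?divr_ge0 ?mulr_ge0 ?pi_ge0 ?ltW//.
  rewrite (_ : pi / (2 * r) * (r / 2) = pi * (2^-1) ^+ 2); last first.
    by field; rewrite gt_eqF.
  by rewrite sqrtrM ?pi_ge0// sqrtr_sqr ger0_norm.
rewrite /bessel_coef legendre_coefE addKn doubleK.
have sp : Num.sqrt (pi : R) != 0 by rewrite gt_eqF// sqrtr_gt0 pi_gt0.
set s := Num.sqrt pi in sq sp *; set u := Num.sqrt (r / 2) in sq *.
set v := Num.sqrt _ in sq *.
rewrite (_ : _ * v * _ = (v * u) * ((l.*2.+1)%:R * ((-1) ^+ k /
   (k`!%:R * (((k + l).+1.*2)`!%:R / (4 ^+ (k + l).+1 * (k + l).+1`!%:R) * s)) * (r / 2) ^+ (l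
       + k.*2)))); last by ring.
rewrite sq doubleS !factS expr_div_n (_ : 4 = 2 ^+ 2 :> R); last by rewrite -natrX.
rewrite -exprM.
rewrite (_ : (2 * (k + l).+1 = l + k.*2 + l + 2)%N); last by rewrite -!mul2n; lia.
rewrite [in 2 ^+ (_ + 2)]exprD [2 ^+ (_ + l)]exprD.
have k1 := factr_neq0 R k; have k2 := factr_neq0 R (k + l); have k3 := factr_neq0 R (k + l).*2.
rewrite -!mul2n; rewrite -!mul2n in k3; field.
rewrite k1 k2 k3 sp !expf_neq0//= !gt_eqF//; do ?[by rewrite ltr_pwDl ?mulr_ge0 ?addr_ge0].
Qed.

(** [besselJ] is a bare [limn], so its convergence must be supplied: up to the factor $c$ its
    partial sums are those of [bessel_coef] at the indices $l+2K$, and the latter series is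
    dominated by that of $e^r$. *)
Lemma cvg_bessel_coef r l : 0 < r ->
  series (bessel_coef r l) @ \oo --> (l.*2.+1)%:R * sph_bessel_pos l r.
Proof.
move=> r0; have cB := @is_cvg_series_bessel_coef r l (ltW r0).
set G := limn (series (bessel_coef r l)) in cB.
pose c := (l.*2.+1)%:R * Num.sqrt (pi / (2 * r)).
have c0 : c != 0.
  by rewrite mulf_neq0 ?pnatr_eq0// gt_eqF// sqrtr_gt0 divr_gt0 ?pi_gt0// mulr_gt0.
pose t k : R := (-1) ^+ k / (k`!%:R * Gamma (k%:R + (l%:R + 1 / 2) + 1)) *
      (r / 2) `^ (2 * k%:R + (l%:R + 1 / 2)).
have st K : series t K = c^-1 * series (bessel_coef r l) (l + K.*2)%N.
  rewrite series_bessel_coef mulr_sumr; apply: eq_bigr => k _.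
  by rewrite -bessel_term// -/(t k) -/c mulKf.
have sub : (l + K.*2)%N @[K --> \oo] --> \oo.
  move=> A [N _ NA]; exists N => // n /= Nn; apply: NA => /=.
  by rewrite (leq_trans Nn)// -addnn addnA leq_addl.
have ct : series t @ \oo --> c^-1 * G.
  rewrite (_ : series t = fun K => c^-1 * series (bessel_coef r l) (l + K.*2)%N); last first.
    exact/funext.
  apply: cvgMr; exact: (cvg_comp _ _ sub cB).
rewrite /sph_bessel_pos /besselJ -/t (cvg_lim _ ct)//.
by rewrite mulrA -/c mulrA divff// mul1r.
Qed.

End Bessel.

Local Open Scope complex_scope.

(** * The complex exponential and the Jacobi-Anger expansion *)

Section ComplexLimits.
Variable R : realType.

(** The norm of [R[i]] takes its values in [R[i]]; this trades it for a real majorant. *)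
Lemma cvg_complex_squeeze {T : Type} {F : set_system T} {FF : Filter F}
    (f : T -> R[i]) (l : R[i]) (g : T -> R) :
  (\forall x \near F, `|f x - l| <= (g x)%:C) -> g x @[x --> F] --> (0 : R) ->
  f x @[x --> F] --> l.
Proof.
move=> fg g0; apply/cvgrPdist_lt => e e0.
have [e1 e1_gt0 e1E] : exists2 e1 : R, 0 < e1 & e = e1%:C.
  move: e e0 => [a b]; rewrite ltcE /= => /andP[/eqP b0 a0].
  by exists a => //; rewrite b0.
move/cvgrPdist_lt : g0 => /(_ _ e1_gt0) g0.
rewrite e1E; near=> x.
rewrite distrC (@le_lt_trans _ _ (g x)%:C)//; first by near: x.
rewrite ltcR (le_lt_trans (ler_norm _))// -normrN -sub0r.
by near: x.
Unshelve. all: by end_near. Qed.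

(* The difference is small because replacing [a] and [b] by their norms turns it
   into a sequence converging to [e ^ (|a| + |b|) - e ^ (|a| + |b|)]. *)
Lemma exp_partial_sub (K : numFieldType) (a b : K) N :
  (\sum_(j < N) a ^+ j / j`!%:R) * (\sum_(k < N) b ^+ k / k`!%:R)
    - \sum_(n < N) (a + b) ^+ n / n`!%:R =
  \sum_(j < N) \sum_(k < N | (N <= j + k)%N) (a ^+ j / j`!%:R) * (b ^+ k / k`!%:R).
Proof.
pose f j k : K := (a ^+ j / j`!%:R) * (b ^+ k / k`!%:R).
have E n : (a + b) ^+ n / n`!%:R = \sum_(j < n.+1) f j (n - j)%N.
  rewrite exprDn_comm; last exact: mulrC.
  rewrite mulr_suml [RHS](reindex_inj rev_ord_inj) /=.
  apply: eq_bigr => i _; rewrite subSS subKn -1?ltnS// /f.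
  have := bin_fact (leq_ord i) => /(congr1 (fun n => n%:R : K)).
  rewrite !natrM => <-; rewrite -mulr_natl.
  have k1 := factr_neq0 K i; have k2 := factr_neq0 K (n - i).
  have k3 : 'C(n, i)%:R != 0 :> K by rewrite pnatr_eq0 -lt0n bin_gt0 leq_ord.
  by field; rewrite k1 k2 k3.
rewrite mulr_suml; under eq_bigr do rewrite mulr_sumr.
apply/eqP; rewrite subr_eq; apply/eqP.
have -> : \sum_(n < N) (a + b) ^+ n / n`!%:R = \sum_(j < N) \sum_(k < N | (j + k < N)%N) f j k.
  under eq_bigr do rewrite E.
  transitivity (\sum_(j < N) \sum_(k < N - j) f j k).
    elim: N => [|N IH]; first by rewrite !big_ord0.
    rewrite big_ord_recr /= IH [RHS]big_ord_recr /= subSnn big_ord1.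
    rewrite [X in _ + X]big_ord_recr /= subnn addrA; congr (_ + _).
    rewrite -big_split /=; apply: eq_bigr => j _.
    by rewrite subSn ?big_ord_recr// ltnW.
  apply: eq_bigr => j _.
  rewrite (big_ord_widen _ _ (leq_subr j N)).
  by apply: eq_bigl => k; rewrite ltn_subRL.
rewrite -big_split /=; apply: eq_bigr => j _.
rewrite (bigID (fun k : 'I_N => (N <= j + k)%N)) /=; congr (_ + _).
by apply: eq_bigl => k; rewrite ltnNge.
Qed.

Lemma norm_exp_partial_sub (K : numFieldType) (a b : K) N :
  `|(\sum_(j < N) a ^+ j / j`!%:R) * (\sum_(k < N) b ^+ k / k`!%:R)
    - \sum_(n < N) (a + b) ^+ n / n`!%:R| <=
  (\sum_(j < N) `|a| ^+ j / j`!%:R) * (\sum_(k < N) `|b| ^+ k / k`!%:R)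
    - \sum_(n < N) (`|a| + `|b|) ^+ n / n`!%:R.
Proof.
rewrite !exp_partial_sub (le_trans (ler_norm_sum _ _ _))//; apply: ler_sum => j _.
rewrite (le_trans (ler_norm_sum _ _ _))//; apply: ler_sum => k _.
by rewrite !normrM !normfV !normrX !normr_nat.
Qed.

Lemma norm_realC (a : R) : `|a%:C| = `|a|%:C.
Proof. by rewrite normc_def /= expr0n addr0 sqrtr_sqr. Qed.

Definition exp_partial (w : R[i]) N := \sum_(n < N) w ^+ n / n`!%:R.

Lemma norm_exp_partialB (u v : R[i]) N :
  `|exp_partial u N * exp_partial v N - exp_partial (u + v) N| <=
  exp_partial `|u| N * exp_partial `|v| N - exp_partial (`|u| + `|v|) N.
Proof. exact: norm_exp_partial_sub. Qed.

Lemma series_exp_coeffE (a : R) N : series (exp_coeff a) N = \sum_(n < N) a ^+ n / n`!%:R.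
Proof. by rewrite /series /= big_mkord. Qed.

Lemma exp_partial_real (a : R) N : exp_partial a%:C N = (series (exp_coeff a) N)%:C.
Proof.
rewrite series_exp_coeffE rmorph_sum; apply: eq_bigr => n _.
by rewrite rmorphM /= fmorphV rmorphXn rmorph_nat.
Qed.

Lemma exp_partial_imag (b : R) N :
  exp_partial ('i * b%:C) N = series (cos_coeff b) N +i* series (sin_coeff b) N.
Proof.
elim: N => [|N IH]; first by rewrite /exp_partial /series /= big_ord0 !big_geq.
rewrite /exp_partial big_ord_recr /= -/(exp_partial _ _) IH !seriesSr.
have -> : ('i * b%:C) ^+ N / N`!%:R = cos_coeff b N +i* sin_coeff b N.
  rewrite exprMn -rmorphXn /= -(rmorph_nat (real_complex R)) -fmorphV -mulrA -rmorphM /=.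
  have sqi : 'i ^+ 2 = (-1)%:C :> R[i] by rewrite expr2; simpc.
  have iN : 'i ^+ N = ((~~ odd N)%:R * (-1) ^+ N./2) +i* ((odd N)%:R * (-1) ^+ N.-1./2) :> R[i].
    rewrite -{1}(odd_double_half N) -mul2n exprD exprM sqi -rmorphXn /=.
    have [oN|eN] := boolP (odd N); last by rewrite expr0 mul1r mul1r mul0r.
    rewrite expr1 !mul0r mul1r (_ : N.-1./2 = N./2).
      by simpc.
    by case: N oN {IH} => //= N; rewrite uphalf_half => /negPf ->.
  rewrite iN /cos_coeff /sin_coeff /= exprnP; simpc.
  by rewrite !mulrA.
by [].
Qed.

Lemma cvg_real_complex {T : Type} {F : set_system T} {FF : Filter F} (f : T -> R) (a : R) :
  f x @[x --> F] --> a -> (f x)%:C @[x --> F] --> a%:C.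
Proof.
move=> fa; apply: (cvg_complex_squeeze (g := fun x => `|f x - a|)).
  by near=> x; rewrite -rmorphB norm_realC.
rewrite -(normr0 R) -(subrr a); apply: cvg_norm; apply: cvgB => //; exact: cvg_cst.
Unshelve. all: by end_near. Qed.

(** [cexp] is built from real functions. The partial sums for $a$ and for $ib$ converge to its two
    factors, and their product differs from the partial sum for $a+ib$ by [D], which tends to
    $0$. *)
Lemma cvg_exp_partial (w : R[i]) : exp_partial w @ \oo --> cexp w.
Proof.
case: w => a b; rewrite [_ +i* _]complexE.
have ca (x : R) : series (exp_coeff x) @ \oo --> expR x.
  rewrite /expR; exact: is_cvg_series_exp_coeff.
have c1 : exp_partial a%:C @ \oo --> (expR a)%:C.
  rewrite (_ : exp_partial _ = fun N => (series (exp_coeff a) N)%:C).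
    exact: cvg_real_complex.
  by apply/funext => N; rewrite exp_partial_real.
have c2 : exp_partial ('i * b%:C) @ \oo --> cos b +i* sin b.
  rewrite (_ : exp_partial _ = fun N =>
      (series (cos_coeff b) N)%:C + 'i * (series (sin_coeff b) N)%:C); last first.
    by apply/funext => N; rewrite exp_partial_imag [LHS]complexE.
  rewrite [X in _ --> X]complexE /=; apply: cvgD.
    by apply: cvg_real_complex; rewrite unlock; exact: is_cvg_series_cos_coeff.
  apply: cvgMr; apply: cvg_real_complex.
  by rewrite unlock; exact: is_cvg_series_sin_coeff.
pose D N := exp_partial a%:C N * exp_partial ('i * b%:C) N - exp_partial (a%:C + 'i * b%:C) N.
have cD : D @ \oo --> (0 : R[i]).
  apply: (cvg_complex_squeeze (g := fun N => series (exp_coeff `|a|) N * series (exp_coeff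
      `|b|) N - series (exp_coeff (`|a| + `|b|)) N)).
    near=> N; rewrite subr0 (le_trans (norm_exp_partialB _ _ _))//.
    rewrite normrM norm_realC norm_realC (_ : `|'i| = 1) ?mul1r; last by rewrite normc_def /=
        expr0n expr1n add0r sqrtr1.
    by rewrite -rmorphD !exp_partial_real rmorphB rmorphM.
  rewrite -(subrr (expR `|a| * expR `|b|)) -[in X in _ --> _ - X]expRD.
  by apply: cvgB => //; apply: cvgM.
rewrite (_ : exp_partial _ = fun N => exp_partial a%:C N * exp_partial ('i * b%:C) N - D N);
    last first.
  by apply/funext => N; rewrite /D subKr.
have [re im] : complex.Re (a%:C + 'i * b%:C) = a /\ complex.Im (a%:C + 'i * b%:C) = b.
  by simpc.
rewrite /cexp re im -[X in _ --> X]subr0.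
apply: cvgB; last exact: cD.
exact: (cvgM c1 c2).
Unshelve. all: by end_near. Qed.

End ComplexLimits.

(** * The Jacobi-Anger expansion at complex argument *)

Section JacobiAnger.
Variable R : realType.
Implicit Types (r : R) (w : R[i]).

Lemma legendre_coefC n l : legendre_coef R[i] n l = (legendre_coef R n l)%:C.
Proof.
rewrite /legendre_coef; case: ifP => _; last by rewrite rmorph0.
by rewrite fmorph_div !rmorphM rmorphXn /= !rmorph_nat.
Qed.

(** Where the coefficient is nonzero, $n-l$ is even and $i^n = i^l(-1)^{(n-l)/2}$. *)
Lemma iexpr_legendre_coef r n l :
  ('i * r%:C) ^+ n * legendre_coef R[i] n l = 'i ^+ l * (bessel_coef r l n)%:C.
Proof.
rewrite legendre_coefC /bessel_coef.
have [nl|ln] := ltnP n l; first by rewrite legendre_coef_out// !mulr0.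
have [od|ev] := boolP (odd (n + l)); first by rewrite legendre_coef_odd// !mulr0.
have nE : n = (l + 2 * (n - l)./2)%N.
  rewrite mul2n halfK oddB// -oddD (negPf ev) subn0 subnKC//.
have sqi : 'i ^+ 2 = (-1)%:C :> R[i] by rewrite expr2; simpc.
rewrite exprMn {1}nE exprD exprM sqi !rmorphM !rmorphXn /=.
by rewrite !mulrA.
Qed.

(** Cutting both sums at the same $N$ keeps the exchange finite; each $P_l$ then carries a partial
    sum of the series for $(2l+1)j_l$ in place of its value. *)
Lemma exp_partial_legendre r w N :
  exp_partial ('i * r%:C * w) N =
  \sum_(l < N) 'i ^+ l * (series (bessel_coef r l) N)%:C * (legendre_poly R[i] l).[w].
Proof.
rewrite /exp_partial.
transitivity (\sum_(n < N) \sum_(l < N)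
    ('i * r%:C) ^+ n * legendre_coef R[i] n l * (legendre_poly R[i] l).[w]).
  apply: eq_bigr => n _; rewrite exprMn -mulrA exprn_legendre.
  rewrite mulr_sumr (big_ord_widen N (fun l => ('i * r%:C) ^+ n * (legendre_coef R[i] n l *
      (legendre_poly R[i] l).[w])))//.
  rewrite [RHS](bigID (fun l : 'I_N => (l < n.+1)%N)) /= [X in _ + X]big1 ?addr0.
    by apply: eq_bigr => l _; rewrite mulrA.
  by move=> l; rewrite -leqNgt => nl; rewrite legendre_coef_out// mulr0 mul0r.
rewrite exchange_big /=; apply: eq_bigr => l _.
rewrite -mulr_suml; congr (_ * _).
under eq_bigr do rewrite iexpr_legendre_coef.
by rewrite -mulr_sumr /series /= big_mkord rmorph_sum.
Qed.

Lemma sum_bessel_coef_tail r (rho : R) N : 0 < r -> 1 <= rho ->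
  \sum_(l < N) `|(l.*2.+1)%:R * sph_bessel_pos l r - series (bessel_coef r l) N| * rho ^+ l <=
  expR (r * rho) - series (exp_coeff (r * rho)) N.
Proof.
move=> r0 rho1.
have rho0 : 0 <= rho by rewrite (le_trans ler01).
(* Bounds finite blocks $N \le n < M$ first; $M \to \infty$ then gives the claim. *)
have fin M : (N <= M)%N ->
  \sum_(l < N) `|series (bessel_coef r l) M - series (bessel_coef r l) N| * rho ^+ l <=
  series (exp_coeff (r * rho)) M - series (exp_coeff (r * rho)) N.
  move=> NM; rewrite sub_series_geq//.
  under eq_bigr do rewrite sub_series_geq//.
  apply: (@le_trans _ _ (\sum_(l < N) \sum_(N <= n < M) r ^+ n * (legendre_coef R n l * rho ^+
      l))).
    apply: ler_sum => l _.
    have -> : \sum_(N <= n < M) r ^+ n * (legendre_coef R n l * rho ^+ l) =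
        (\sum_(N <= n < M) r ^+ n * legendre_coef R n l) * rho ^+ l.
      by rewrite mulr_suml; apply: eq_bigr => n _; rewrite mulrA.
    rewrite ler_wpM2r ?exprn_ge0// (le_trans (ler_norm_sum _ _ _))//.
    by apply: ler_sum => n _; rewrite norm_bessel_coef// ltW.
  rewrite exchange_big /= big_nat [leRHS]big_nat; apply: ler_sum => n /andP[Nn _].
  rewrite -mulr_sumr /exp_coeff /= exprMn -mulrA ler_wpM2l ?exprn_ge0 ?(ltW r0)//.
  (* Here $\rho^l \le \rho^n$ since $l \le n$ and $\rho \ge 1$, and the coefficients sum to $1/n!$,
     so the block is dominated by the terms $(r\rho)^n/n!$. *)
  apply: (@le_trans _ _ (\sum_(l < n.+1) legendre_coef R n l * rho ^+ l)).
    rewrite (big_ord_widen n.+1 (fun l => legendre_coef R n l * rho ^+ l) (leqW Nn)).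
    rewrite [leRHS](bigID (fun l : 'I_n.+1 => (l < N)%N)) /= lerDl.
    by apply: sumr_ge0 => l _; rewrite mulr_ge0 ?exprn_ge0 ?legendre_coef_ge0.
  rewrite -sum_legendre_coef mulr_sumr; apply: ler_sum => l _.
  rewrite mulrC ler_wpM2r ?legendre_coef_ge0//.
  by rewrite ler_weXn2l// -ltnS.
have cR : (series (exp_coeff (r * rho)) M - series (exp_coeff (r * rho)) N) @[M --> \oo]
    --> expR (r * rho) - series (exp_coeff (r * rho)) N.
  by apply: cvgB; [exact: is_cvg_series_exp_coeff|exact: cvg_cst].
have cL : \sum_(l < N) `|series (bessel_coef r l) M - series (bessel_coef r l) N| * rho ^+ l
    @[M --> \oo] --> \sum_(l < N) `|(l.*2.+1)%:R * sph_bessel_pos l r - series (bessel_coef r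
        l) N| * rho ^+ l.
  apply: cvg_big => [|l _]; first exact: add_continuous.
  apply: cvgMl; apply: cvg_norm; apply: cvgB; last exact: cvg_cst.
  exact: cvg_bessel_coef.
apply: (ler_cvg_to cL cR); near=> M; apply: fin.
by near: M; exact: nbhs_infty_ge.
Unshelve. all: by end_near. Qed.

Theorem jacobi_anger r w : 0 < r ->
  series (fun l => 'i ^+ l * ((l.*2.+1)%:R * sph_bessel_pos l r)%:C * (legendre_poly R[i] l).[w])
    @ \oo --> cexp ('i * r%:C * w).
Proof.
move=> r0; set u := (fun l => _).
(* The growth rate from [norm_legendre_le], read as a real number. *)
pose rho := 2 * complex.Re `|w| + 1.
have wE : `|w| = (complex.Re `|w|)%:C by rewrite normc_def.
have rho1 : 1 <= rho.
  by rewrite lerDr mulr_ge0//; have := normr_ge0 w; rewrite {1}wE lecR.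
have rhoE : 2 * `|w| + 1 = rho%:C by rewrite wE rmorphD rmorphM rmorph1 rmorph_nat.
pose d N := series u N - exp_partial ('i * r%:C * w) N.
have cd : d @ \oo --> (0 : R[i]).
  apply: (cvg_complex_squeeze (g := fun N => expR (r * rho) - series (exp_coeff (r * rho)) N)).
    near=> N; rewrite subr0 /d exp_partial_legendre /series /= big_mkord -sumrB.
    apply: (@le_trans _ _ (\sum_(l < N) `|(l.*2.+1)%:R * sph_bessel_pos l r - series
        (bessel_coef r l) N| * rho ^+ l)%:C); last first.
      by rewrite lecR sum_bessel_coef_tail.
    rewrite rmorph_sum (le_trans (ler_norm_sum _ _ _))//; apply: ler_sum => l _.
    rewrite -mulrBl -mulrBr !normrM normrX (_ : `|'i| = 1); last first.
      by rewrite normc_def /= expr0n expr1n add0r sqrtr1.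
    rewrite expr1n mul1r -rmorphB norm_realC rmorphM ler_wpM2l//.
      by rewrite lecR.
    by rewrite rmorphXn /= -rhoE norm_legendre_le.
  rewrite -(subrr (expR (r * rho))); apply: cvgB; first exact: cvg_cst.
  exact: is_cvg_series_exp_coeff.
rewrite (_ : series u = fun N => exp_partial ('i * r%:C * w) N + d N); last first.
  by apply/funext => N; rewrite /d addrC subrK.
rewrite -[X in _ --> X]addr0; apply: cvgD cd; exact: cvg_exp_partial.
Unshelve. all: by end_near. Qed.

End JacobiAnger.

(** * Rotations and spherical harmonics *)

Section Wigner.
Variable R : realType.

Lemma zfact_nat (m : int) k : m = k%:Z -> zfact R m = k`!%:R.
Proof. by move=> ->. Qed.

(** Taking $h^k$ from the first factor fixes its degree $j-k$, so the second must contribute degree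
    $i-(j-k)$; the guard excludes negative degrees. *)
Lemma rot_coef_sum (F : numFieldType) (c h : F) n j i :
  rot_coef c h n j i =
  \sum_(k < j.+1) if (j <= i + k)%N then
    ('C(j, k) * 'C(n - j, i + k - j))%:R * (-1) ^+ (i + k - j) *
      c ^+ ((j - k) + (n - j - (i + k - j))) * h ^+ (k + (i + k - j)) else 0.
Proof.
rewrite /rot_coef exprDn mulr_suml coef_sum; apply: eq_bigr => k _.
have kj : (k <= j)%N by rewrite -ltnS.
rewrite -(mul_polyC c) exprMn.
set q := (_ - _) ^+ _.
have -> : c%:P ^+ (j - k) * 'X^(j - k) * h%:P ^+ k *+ 'C(j, k) * q =
    ('C(j, k)%:R * c ^+ (j - k) * h ^+ k)%:P * ('X^(j - k) * q).
  by rewrite -mulr_natl !polyCM -polyC_natr !polyC_exp; ring.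
rewrite coefCM coefXnM.
have -> : (i < j - k)%N = ~~ (j <= i + k)%N by lia.
case: (boolP (j <= i + k)%N) => /= jik; last by rewrite mulr0.
have -> : (i - (j - k) = i + k - j)%N by lia.
rewrite /q (_ : c%:P - h *: 'X = c%:P + (- h)%:P * 'X); last first.
  by rewrite polyCN mulNr mul_polyC.
rewrite coef_linX -[_ *+ 'C(n - j, _)]mulr_natl -(mulN1r h) exprMn natrM !exprD; ring.
Qed.

(** The indices are $i = l+m$ and $j = l+m'$, and the $k$ of the binomial expansion is Wigner's
    summation index. *)
Lemma rot_coef_wigner l j i (theta : R) : (j <= l.*2)%N -> (i <= l.*2)%N ->
  rot_coef (cos (theta / 2)) (sin (theta / 2)) l.*2 j i =
  (-1) ^+ (i + j) * (Num.sqrt (j`!%:R * (l.*2 - j)`!%:R) / Num.sqrt (i`!%:R * (l.*2 - i)`!%:R))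
    * wigner_d l (i%:Z - l%:Z) (j%:Z - l%:Z) theta.
Proof.
move=> jl il; rewrite rot_coef_sum /wigner_d.
have -> : absz (Num.max 0 (j%:Z - l%:Z - (i%:Z - l%:Z))) = (j - i)%N by lia.
have -> : absz (Num.min (l%:Z - (i%:Z - l%:Z)) (l%:Z + (j%:Z - l%:Z))) = minn (l.*2 - i) j by lia.
set c := cos _; set h := sin _; set m := i%:Z - l%:Z; set m' := j%:Z - l%:Z.
(* Wigner's range of $k$ is widened to $0 \le k \le j$: below it the guard fails, above it a
   binomial coefficient vanishes. *)
rewrite mulr_sumr big_nat (big_nat_widen _ _ j.+1) /=; last by lia.
rewrite (big_nat_widenl _ 0%N)//= big_mkord [RHS]big_mkcond.
apply: eq_bigr => -[k /= kj] _; rewrite ltnS in kj.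
case: (boolP (j <= i + k)%N) => jik; last first.
  by rewrite ifF//; lia.
have [kli|kli] := leqP k (l.*2 - i); last first.
  rewrite ifF; last by lia.
  by rewrite (@bin_small (l.*2 - j)) ?muln0 ?mul0r//; lia.
rewrite ifT; last by lia.
set t := (i + k - j)%N.
rewrite /wigner_w.
rewrite (@zfact_nat (l%:Z + m) i); last by rewrite /m; lia.
rewrite (@zfact_nat (l%:Z - m) (l.*2 - i)); last by rewrite /m; lia.
rewrite (@zfact_nat (l%:Z + m') j); last by rewrite /m'; lia.
rewrite (@zfact_nat (l%:Z - m') (l.*2 - j)); last by rewrite /m'; lia.
rewrite (@zfact_nat (l%:Z - m - k%:Z) (l.*2 - j - t)); last by rewrite /m /t; lia.
rewrite (@zfact_nat (l%:Z + m' - k%:Z) (j - k)); last by rewrite /m'; lia.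
rewrite (@zfact_nat (k%:Z + m - m') t); last by rewrite /m /m' /t; lia.
have -> : 2 * (l%:Z - k%:Z) + m' - m = ((j - k) + (l.*2 - j - t))%N by rewrite /m /m' /t; lia.
have -> : 2 * k%:Z + m - m' = (k + t)%N by rewrite /m /m' /t; lia.
rewrite -!exprnP.
set A := i`!%:R * (l.*2 - i)`!%:R; set B := j`!%:R * (l.*2 - j)`!%:R.
have A0 : 0 < A by rewrite mulr_gt0 ?ltr0n ?fact_gt0.
have B0 : 0 < B by rewrite mulr_gt0 ?ltr0n ?fact_gt0.
rewrite -[_ * j`!%:R * _]mulrA -/B (sqrtrM B (ltW A0)).
have sA : Num.sqrt A != 0 by rewrite gt_eqF ?sqrtr_gt0.
have sB : Num.sqrt B * Num.sqrt B = B by rewrite -expr2 sqr_sqrtr// ltW.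
have sg : (-1) ^+ t = (-1) ^+ (i + j) * (-1) ^+ k :> R.
  rewrite -exprD -signr_odd -[RHS]signr_odd; congr (_ ^+ _).
  by rewrite /t; lia.
have b1 : 'C(j, k)%:R = j`!%:R / (k`!%:R * (j - k)`!%:R) :> R.
  by rewrite -(bin_fact kj) !natrM mulfK// mulf_neq0// factr_neq0.
have tj : (t <= l.*2 - j)%N by rewrite /t; lia.
have b2 : 'C(l.*2 - j, t)%:R = (l.*2 - j)`!%:R / (t`!%:R * (l.*2 - j - t)`!%:R) :> R.
  by rewrite -(bin_fact tj) !natrM mulfK// mulf_neq0// factr_neq0.
rewrite natrM b1 b2 sg.
set sa := Num.sqrt A in sA *; set sb := Num.sqrt B in sB *.
set X := c ^+ _; set Z := h ^+ _.
rewrite [RHS](_ : _ = (-1) ^+ (i + j) * (-1) ^+ k * (sb * sb) / ((l.*2 - j - t)`!%:R * (j -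
    k)`!%:R * t`!%:R * k`!%:R) * X * Z).
  rewrite sB /B; field.
  by rewrite !factr_neq0.
by field; rewrite !factr_neq0 sA.
Qed.

End Wigner.

(** * Rotations acting on solid harmonics *)

Section Solid.
Variable R : realType.
Implicit Types (v d : 'cV[R[i]]_3) (t : R).

Definition ord31 : 'I_3 := @Ordinal 3 1 isT.
Definition ord32 : 'I_3 := @Ordinal 3 2 isT.

Lemma big_ord3 (V : nmodType) (f : 'I_3 -> V) : \sum_i f i = f ord0 + f ord31 + f ord32.
Proof.
rewrite !big_ord_recl big_ord0 addr0 addrA.
by congr (_ + f _ + f _); apply: val_inj.
Qed.

(* Up to a constant, the solid harmonic of degree [l] and order [j - l]. *)
Definition solid l j v : R[i] :=
  (quad (v ord0 0 + 'i * v ord31 0) (2 * v ord32 0) (- (v ord0 0 - 'i * v ord31 0)) ^+ l)`_j.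

Definition expi t : R[i] := cos t +i* sin t.

Lemma mulii : 'i * 'i = -1 :> R[i].
Proof. by rewrite -expr2 sqr_i. Qed.

Lemma expiE t : expi t = (cos t)%:C + 'i * (sin t)%:C.
Proof. exact: complexE. Qed.

Lemma expiNM t : expi (- t) * expi t = 1.
Proof.
rewrite !expiE cosN sinN.
have cs : (cos t)%:C ^+ 2 + (sin t)%:C ^+ 2 = 1 by rewrite -!rmorphXn -rmorphD cos2Dsin2 rmorph1.
rewrite rmorphN -cs.
transitivity ((cos t)%:C ^+ 2 - 'i * 'i * (sin t)%:C ^+ 2); first by ring.
by rewrite mulii; ring.
Qed.

Lemma expi_neq0 t : expi t != 0.
Proof.
by apply/eqP => e; have := expiNM t; rewrite e mulr0 => /eqP; rewrite eq_sym oner_eq0.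
Qed.

Lemma expiN t : expi (- t) = (expi t)^-1.
Proof. by apply: (mulIf (expi_neq0 t)); rewrite expiNM mulVf ?expi_neq0. Qed.

(** Transposes occur because the rotation is moved across the product: $Rd\cdot x = d\cdot R^Tx$. *)
Lemma RzTE t v : let u := (map_mx (real_complex R) (Rz t))^T *m v in
  [/\ u ord0 0 = (cos t)%:C * v ord0 0 + (sin t)%:C * v ord31 0,
      u ord31 0 = (- sin t)%:C * v ord0 0 + (cos t)%:C * v ord31 0 & u ord32 0 = v ord32 0].
Proof. by rewrite /=; split; rewrite mxE big_ord3 !mxE /= /tnth /=; simpc. Qed.

Lemma RyTE t v : let u := (map_mx (real_complex R) (Ry t))^T *m v in
  [/\ u ord0 0 = (cos t)%:C * v ord0 0 + (- sin t)%:C * v ord32 0,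
      u ord31 0 = v ord31 0 & u ord32 0 = (sin t)%:C * v ord0 0 + (cos t)%:C * v ord32 0].
Proof. by rewrite /=; split; rewrite mxE big_ord3 !mxE /= /tnth /=; simpc. Qed.

(** The inverse rotation multiplies $x+iy$ by $e^{-it}$ and $x-iy$ by $e^{it}$. *)
Lemma solid_Rz l j t v :
  solid l j ((map_mx (real_complex R) (Rz t))^T *m v) =
  expi (- t) ^+ j / expi (- t) ^+ l * solid l j v.
Proof.
rewrite /solid; have [-> -> ->] := RzTE t v.
rewrite -coef_quad_rot ?expi_neq0//; congr ((quad _ _ _ ^+ _)`_ _).
  rewrite expiE cosN sinN rmorphN /=; apply/eqP; rewrite -subr_eq0.
  rewrite (_ : _ - _ = ('i * 'i + 1) * (sin t)%:C * v ord31 0); last by ring.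
  by rewrite mulii addNr !mul0r.
rewrite -expiN opprK expiE rmorphN /=; apply/eqP; rewrite -subr_eq0.
rewrite (_ : _ - _ = - ('i * 'i + 1) * (sin t)%:C * v ord31 0); last by ring.
by rewrite mulii addNr oppr0 !mul0r.
Qed.

Lemma rot_coefC (c h : R) n j i : rot_coef c%:C h%:C n j i = (rot_coef c h n j i)%:C.
Proof.
rewrite /rot_coef -coef_map /= rmorphM !rmorphXn /= rmorphD rmorphB /=.
by rewrite !map_polyZ !map_polyX !map_polyC.
Qed.

Lemma half_angle t : cos t = cos (t / 2) ^+ 2 - sin (t / 2) ^+ 2 /\
  sin t = 2 * (cos (t / 2) * sin (t / 2)).
Proof.
have {1 4}-> : t = t / 2 + t / 2 by field.
by rewrite cosD sinD; split; ring.
Qed.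

Lemma solid_Ry l i t v :
  solid l i ((map_mx (real_complex R) (Ry t))^T *m v) =
  \sum_(j < l.*2.+1) solid l j v * (rot_coef (cos (t / 2)) (sin (t / 2)) l.*2 j i)%:C.
Proof.
rewrite /solid; have [-> -> ->] := RyTE t v.
under eq_bigr do rewrite -rot_coefC.
rewrite -coef_quad_rot_y; have [-> ->] := half_angle t.
set c := cos _; set h := sin _.
have cs : c%:C ^+ 2 + h%:C ^+ 2 = 1 by rewrite -!rmorphXn -rmorphD cos2Dsin2 rmorph1.
(* The fixed coordinate $y$ is multiplied by $c^2+h^2 = 1$ so that everything becomes quadratic in
   $c$ and $h$. The constant coefficient reuses this with $-y$. *)
have E (x y z : R[i]) : (c ^+ 2 - h ^+ 2)%:C * x + (- (2 * (c * h)))%:C * z + 'i * y =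
   (x + 'i * y) * c%:C ^+ 2 - 2 * z * c%:C * h%:C + (- (x - 'i * y)) * h%:C ^+ 2.
  transitivity ((c ^+ 2 - h ^+ 2)%:C * x + (- (2 * (c * h)))%:C * z + 'i * y * (c%:C ^+ 2 +
      h%:C ^+ 2)).
    by rewrite cs mulr1.
  by ring.
congr ((quad _ _ _ ^+ _)`_ _).
- exact: E.
- by ring.
- have := E (v ord0 0) (- v ord31 0) (v ord32 0); rewrite !mulrN => ->; ring.
Qed.

Lemma solid_Rot l i (th : R * R) psi v :
  solid l i ((map_mx (real_complex R) (Rot th psi))^T *m v) =
  expi (- psi) ^+ i / expi (- psi) ^+ l *
  \sum_(j < l.*2.+1) expi (- th.2) ^+ j / expi (- th.2) ^+ l * solid l j v *
    (rot_coef (cos (th.1 / 2)) (sin (th.1 / 2)) l.*2 j i)%:C.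
Proof.
rewrite /Rot !map_mxM !trmx_mul -!mulmxA solid_Rz solid_Ry.
by congr (_ * _); apply: eq_bigr => j _; rewrite solid_Rz.
Qed.

(** The condition $d\cdot d = 1$ says that the outer coefficients multiply to $d_z^2-1$, as
    [coef_quad_nderiv] requires. *)
Lemma solid_zonal l d : \sum_i d i 0 ^+ 2 = 1 ->
  solid l l d = 2 ^+ l * (legendre_poly R[i] l).[d ord32 0].
Proof.
rewrite big_ord3 => d1; rewrite /solid.
rewrite -[X in _`_X]addn0 coef_quad_nderiv; last first.
  apply/eqP; rewrite -subr_eq0 -d1.
  rewrite (_ : _ - _ = ('i * 'i + 1) * d ord31 0 ^+ 2); last by ring.
  by rewrite mulii addNr mul0r.
rewrite addn0 expr0 mul1r /legendre_poly nderivn_def hornerZ hornerMn -mulr_natl.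
have k1 := factr_neq0 R[i] l; field.
by rewrite k1 expf_neq0//= pnatr_eq0.
Qed.

End Solid.

(** * The addition theorem *)

Section Addition.
Variable R : realType.
Implicit Types (v d : 'cV[R[i]]_3) (t : R) (a : R * R).

Definition complex_vec (x : 'cV[R]_3) : 'cV[R[i]]_3 := map_mx (real_complex R) x.

(** At the north pole the quadratic is $2s$, whose powers are monomials; rotating it to a general
    point leaves the single row $l$ of [rot_coef]. *)
Lemma quad_sphere l j t phi :
  (quad (expi phi * (sin t)%:C) (2 * (cos t)%:C) ((expi phi)^-1 * - (sin t)%:C) ^+ l)`_j =
  expi phi ^+ j / expi phi ^+ l *
    (2 ^+ l * (rot_coef (cos (t / 2)) (- sin (t / 2)) l.*2 l j)%:C).
Proof.
rewrite coef_quad_rot ?expi_neq0//; congr (_ * _).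
have [-> ->] := half_angle t; set c := cos _; set h := sin _.
have -> : quad (2 * (c * h))%:C (2 * (c ^+ 2 - h ^+ 2)%:C) (- (2 * (c * h))%:C) =
  quad (0 * c%:C ^+ 2 - 2 * c%:C * (- h)%:C + 0 * (- h)%:C ^+ 2)
    (2 * 0 * c%:C * (- h)%:C + 2 * (c%:C ^+ 2 - (- h)%:C ^+ 2) - 2 * 0 * c%:C * (- h)%:C)
    (0 * (- h)%:C ^+ 2 + 2 * c%:C * (- h)%:C + 0 * c%:C ^+ 2).
  by congr quad; ring.
rewrite coef_quad_rot_y.
have q2 j' : (quad 0 2 0 ^+ l : {poly R[i]})`_j' = 2 ^+ l *+ (j' == l).
  by rewrite /quad scale0r add0r addr0 exprZn coefZ coefXn mulr_natr.
have ll : (l < l.*2.+1)%N by rewrite ltnS -addnn leq_addr.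
rewrite (bigD1 (Ordinal ll)) //= big1 => [|j' jl]; last first.
  by rewrite q2 -val_eqE in jl *; rewrite (negPf jl) mulr0n mul0r.
by rewrite q2 eqxx mulr1n addr0 rot_coefC.
Qed.

Lemma sph_pointE a : let u := complex_vec (sph_point a) in
  [/\ u ord0 0 = (sin a.1)%:C * (cos a.2)%:C, u ord31 0 = (sin a.1)%:C * (sin a.2)%:C &
      u ord32 0 = (cos a.1)%:C].
Proof. by split; rewrite !mxE /tnth /= ?rmorphM. Qed.

Lemma sph_pointM a :
  (sin a.1)%:C * (cos a.2)%:C + 'i * ((sin a.1)%:C * (sin a.2)%:C) = expi a.2 * (sin a.1)%:C
  /\ (sin a.1)%:C * (cos a.2)%:C - 'i * ((sin a.1)%:C * (sin a.2)%:C) =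
     (expi a.2)^-1 * (sin a.1)%:C.
Proof. by rewrite -expiN !expiE cosN sinN rmorphN; split; ring. Qed.

Lemma solid_sph_point_rev l j a : (j <= l.*2)%N ->
  solid l (l.*2 - j) (complex_vec (sph_point a)) =
  (-1) ^+ (l + j) * (expi (- a.2) ^+ j / expi (- a.2) ^+ l *
    (2 ^+ l * (rot_coef (cos (a.1 / 2)) (- sin (a.1 / 2)) l.*2 l j)%:C)).
Proof.
move=> jl; rewrite -quad_sphere /solid (coef_quad_conj _ _ _ jl).
have [-> -> ->] := sph_pointE a.
have [-> ->] := sph_pointM a.
by rewrite expiN invrK mulrN.
Qed.

Lemma expi0 : expi (0 : R) = 1.
Proof. by rewrite /expi cos0 sin0. Qed.

Lemma sumsq_Rot (th : R * R) psi v :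
  \sum_i ((map_mx (real_complex R) (Rot th psi))^T *m v) i 0 ^+ 2 = \sum_i v i 0 ^+ 2.
Proof.
have cs t : (cos t)%:C ^+ 2 + (sin t)%:C ^+ 2 = 1 :> R[i].
  by rewrite -!rmorphXn -rmorphD cos2Dsin2 rmorph1.
have Hz t (u : 'cV[R[i]]_3) : \sum_i ((map_mx (real_complex R) (Rz t))^T *m u) i 0 ^+ 2 =
    \sum_i u i 0 ^+ 2.
  rewrite !big_ord3; have [-> -> ->] := RzTE t u.
  by rewrite -[u ord0 0 ^+ 2]mul1r -[u ord31 0 ^+ 2]mul1r -(cs t); ring.
have Hy t (u : 'cV[R[i]]_3) : \sum_i ((map_mx (real_complex R) (Ry t))^T *m u) i 0 ^+ 2 =
    \sum_i u i 0 ^+ 2.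
  rewrite !big_ord3; have [-> -> ->] := RyTE t u.
  by rewrite -[u ord0 0 ^+ 2]mul1r -[u ord32 0 ^+ 2]mul1r -(cs t); ring.
by rewrite /Rot !map_mxM !trmx_mul -!mulmxA Hz Hy Hz.
Qed.

(** The rotation with angles [a] carries the north pole to [sph_point a]. *)
Lemma Rot_pole a d :
  ((map_mx (real_complex R) (Rot a 0))^T *m d) ord32 0 =
  \sum_i d i 0 * complex_vec (sph_point a) i 0.
Proof.
rewrite /Rot !map_mxM !trmx_mul -!mulmxA.
have [_ _ ->] := RzTE 0 ((map_mx (real_complex R) (Ry a.1))^T *m ((map_mx (real_complex R) (Rz
    a.2))^T *m d)).
have [_ _ ->] := RyTE a.1 ((map_mx (real_complex R) (Rz a.2))^T *m d).
have [-> _ ->] := RzTE a.2 d.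
by rewrite big_ord3 !mxE /= /tnth /=; ring.
Qed.

(** The middle coefficient at $R^Td$ is $2^lP_l(d\cdot x)$, and by rotation a sum over the column
    $l$ of [rot_coef]. [rot_coef_dual] turns this column into the row that describes the point $x$,
    whose own factor $2^l$ completes $4^l$. *)
Lemma legendre_solid l a d : \sum_i d i 0 ^+ 2 = 1 ->
  4 ^+ l * (legendre_poly R[i] l).[\sum_i d i 0 * complex_vec (sph_point a) i 0] =
  \sum_(j < l.*2.+1) 'C(l.*2, l)%:R / 'C(l.*2, j)%:R * (-1) ^+ (l + j) *
     solid l (l.*2 - j) (complex_vec (sph_point a)) * solid l j d.
Proof.
move=> d1; rewrite -Rot_pole.
have := @solid_Rot R l l a 0 d.
rewrite solid_zonal ?sumsq_Rot// oppr0 expi0 !expr1n divr1 mul1r => H.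
have -> : 4 = 2 * 2 :> R[i] by rewrite -natrM.
rewrite exprMn -mulrA H mulr_sumr; apply: eq_bigr => j _.
have jl : (j <= l.*2)%N by rewrite -ltnS.
rewrite solid_sph_point_rev//.
have b0 : 'C(l.*2, j)%:R != 0 :> R by rewrite pnatr_eq0 -lt0n bin_gt0.
have D : rot_coef (cos (a.1 / 2)) (sin (a.1 / 2)) l.*2 j l =
   'C(l.*2, l)%:R / 'C(l.*2, j)%:R * rot_coef (cos (a.1 / 2)) (- sin (a.1 / 2)) l.*2 l j.
  by apply: (mulfI b0); rewrite rot_coef_dual mulrA mulrCA divff// mulr1.
rewrite D !rmorphM fmorphV !rmorph_nat.
set r := (rot_coef _ _ _ _ _)%:C.
have sg : (-1) ^+ (l + j) * (-1) ^+ (l + j) = 1 :> R[i] by rewrite -exprD addnn -mul2n exprM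
    sqrrN expr1n expr1n.
transitivity ((-1) ^+ (l + j) * (-1) ^+ (l + j) * 2 ^+ l * (expi (- a.2) ^+ j / expi (- a.2) ^+
    l * solid l j d * ('C(l.*2, l)%:R / 'C(l.*2, j)%:R * r))).
  by rewrite sg mul1r.
by ring.
Qed.

Lemma addition_theorem l a d : \sum_i d i 0 ^+ 2 = 1 -> d ord31 0 = 0 ->
  4 ^+ l * l`!%:R ^+ 2 * (legendre_poly R[i] l).[\sum_i d i 0 * complex_vec (sph_point a) i 0] =
  \sum_(j < l.*2.+1) j`!%:R * (l.*2 - j)`!%:R *
     solid l j (complex_vec (sph_point a)) * solid l j d.
Proof.
move=> d1 dy; rewrite mulrAC legendre_solid// mulr_suml.
rewrite (reindex_inj rev_ord_inj) /=; apply: eq_bigr => j _.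
have jl : (j <= l.*2)%N by rewrite -ltnS.
rewrite subSS subKn//.
(* With second coordinate $0$ the quadratic is $d_xs^2+2d_zs-d_x$, which $s \mapsto -1/s$ preserves
   up to the factor $s^2$ and a sign. *)
have -> : solid l (l.*2 - j) d = (-1) ^+ (l + j) * solid l j d.
  rewrite /solid dy mulr0 addr0 subr0 coef_quad_conj//.
have sg : (-1) ^+ (l + (l.*2 - j)) * (-1) ^+ (l + j) = 1 :> R[i].
  rewrite -exprD -signr_odd (_ : odd _ = false)//; lia.
have f1 := factr_neq0 R[i] l; have f2 := factr_neq0 R[i] j; have f3 := factr_neq0 R[i] (l.*2 - j).
have f4 := factr_neq0 R[i] l.*2.
have b1 : 'C(l.*2, l)%:R = (l.*2)`!%:R / (l`!%:R * l`!%:R) :> R[i].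
  have ll : (l <= l.*2)%N by rewrite -addnn leq_addr.
  have := bin_fact ll; rewrite (_ : l.*2 - l = l)%N; last by rewrite -addnn addnK.
  move=> <-.
  by rewrite !natrM mulfK// mulf_neq0.
have b2 : 'C(l.*2, l.*2 - j)%:R = (l.*2)`!%:R / (j`!%:R * (l.*2 - j)`!%:R) :> R[i].
  by rewrite bin_sub// -(bin_fact jl) !natrM mulfK// mulf_neq0.
rewrite b1 b2.
set u := solid l j (complex_vec _); set w := solid l j d.
rewrite [LHS](_ : _ = ((-1) ^+ (l + (l.*2 - j)) * (-1) ^+ (l + j)) * (j`!%:R * (l.*2 - j)`!%:R
    * u * w)).
  by rewrite sg mul1r.
by field; rewrite f1 f2 f3 f4.
Qed.

End Addition.

(** * Ferrers and associated Legendre functions as coefficients *)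

Section Harmonics.
Variable R : realType.
Implicit Types (x z t : R) (a : R * R).

Lemma derive1n_horner (p : {poly R}) n : derive1n n (horner p) = horner (derivn n p).
Proof.
elim: n => [|n IH]; first by rewrite derive1n0.
by rewrite derive1nS IH -derivE derivnS.
Qed.

Lemma rodriguesE l n x :
  rodrigues l n x = n`!%:R * (nderivn n (('X^2 - 1) ^+ l)).[x].
Proof.
rewrite /rodrigues (_ : (fun t => _) = horner (('X^2 - 1) ^+ l)).
  by rewrite derive1n_horner nderivn_def hornerMn mulr_natl.
by apply/funext => t; rewrite !hornerE.
Qed.

Lemma horner_nderivC (p : {poly R}) n x :
  (nderivn n (map_poly (real_complex R) p)).[x%:C] = (nderivn n p).[x]%:C.
Proof. by rewrite nderivn_map horner_map. Qed.

Lemma map_poly_rodrigues l :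
  map_poly (real_complex R) (('X^2 - 1) ^+ l) = ('X^2 - 1) ^+ l.
Proof. by rewrite rmorphXn /= rmorphB rmorph1 /= map_polyXn. Qed.

Lemma cexp_iR t : cexp ('i * t%:C) = expi t.
Proof.
have [re im] : complex.Re ('i * t%:C) = 0 /\ complex.Im ('i * t%:C) = t by simpc.
by rewrite /cexp re im expR0 mul1r.
Qed.

Lemma expiD t x : expi (t + x) = expi t * expi x.
Proof. by rewrite /expi cosD sinD; simpc; rewrite [X in _ +i* X]addrC. Qed.

Lemma expiMn t n : expi (n%:R * t) = expi t ^+ n.
Proof.
elim: n => [|n IH]; first by rewrite mul0r expi0 expr0.
by rewrite -natr1 mulrDl mul1r expiD IH exprSr.
Qed.

Lemma expiMz t (j l : nat) : expi ((j%:Z - l%:Z)%:~R * t) = expi t ^+ j / expi t ^+ l.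
Proof. by rewrite rmorphB /= mulrBl expiD expiN !expiMn. Qed.

Lemma conj_expi t : (expi t)^*%C = expi (- t).
Proof. by rewrite /expi cosN sinN. Qed.

Lemma powR_half (y : R) k : 0 <= y -> y `^ (k%:R / 2) = Num.sqrt y ^+ k.
Proof.
by move=> y0; rewrite mulrC powRrM powR12_sqrt// powR_mulrn// sqrtr_ge0.
Qed.

Lemma weight_cases l j : (j <= l.*2)%N ->
  (exists k, j = (l + k)%N /\ j%:Z - l%:Z = Posz k) \/
  (exists k, j = (l - k.+1)%N /\ (k.+1 <= l)%N /\ j%:Z - l%:Z = Negz k).
Proof.
move=> jl; have [lj|jl'] := leqP l j.
  by left; exists (j - l)%N; split; lia.
by right; exists (l - j).-1; split; [lia|split; lia].
Qed.

Lemma ferrers_Negz l k x : ferrers l (Negz k) x =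
  (-1) ^+ k.+1 * (zfact R (l%:Z - k.+1%:Z) / zfact R (l%:Z + k.+1%:Z)) * ferrers_nat l k.+1 x.
Proof. by []. Qed.

Lemma legendre_Negz l k x : legendre l (Negz k) x =
  zfact R (l%:Z - k.+1%:Z) / zfact R (l%:Z + k.+1%:Z) * legendre_nat l k.+1 x.
Proof. by []. Qed.

(** Taylor's formula for orders $m \ge 0$, reflected to $m < 0$ by [coef_quad_conj]. The polar angle
    lies in $[0,\pi]$, so $(1-\cos^2)^{m/2}$ is $\sin^m$ with no absolute value. *)
Lemma ferrers_solid l j a : Theta a -> (j <= l.*2)%N ->
  expi ((j%:Z - l%:Z)%:~R * a.2) * (ferrers l (j%:Z - l%:Z) (cos a.1))%:C =
  (-1) ^+ (l + j) * (j`!%:R / (2 ^+ l * l`!%:R)) * solid l j (complex_vec (sph_point a)).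
Proof.
move=> [/= ta _] jl.
have s0 : 0 <= sin a.1.
  by move: ta; rewrite in_itv/= => ta; exact: sin_ge0_pi.
have nat_case k : (ferrers_nat l k (cos a.1))%:C =
    (-1) ^+ k * ((l + k)`!%:R / (2 ^+ l * l`!%:R)) *
      ((sin a.1)%:C ^+ k * (nderivn (l + k) (('X^2 - 1) ^+ l)).[(cos a.1)%:C]).
  rewrite /ferrers_nat rodriguesE powR_half; last first.
    by rewrite -sin2cos2 sqr_ge0.
  rewrite -sin2cos2 sqrtr_sqr ger0_norm//.
  rewrite -map_poly_rodrigues horner_nderivC.
  rewrite !rmorphM fmorphV !rmorphM !rmorphXn rmorphN1 /= !rmorph_nat.
  by ring.
have sq : (expi a.2 * (sin a.1)%:C) * ((expi a.2)^-1 * - (sin a.1)%:C) = (cos a.1)%:C ^+ 2 - 1.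
  rewrite mulrACA divff ?expi_neq0// mul1r mulrN -expr2 -!rmorphXn /= sin2cos2 rmorphB rmorph1.
  by rewrite opprB.
have [[k [jE ->]]|[k [jE [kl mE]]]] := weight_cases jl.
  rewrite /= nat_case /solid; have [-> -> ->] := sph_pointE a; have [-> ->] := sph_pointM a.
  rewrite -mulrN jE coef_quad_nderiv//.
  rewrite expiMn exprMn addnA addnn exprD -mul2n exprM sqrrN expr1n expr1n mul1r.
  by ring.
have jE2 : j = (l.*2 - (l + k.+1))%N by lia.
have -> : expi ((j%:Z - l%:Z)%:~R * a.2) = (expi a.2)^-1 ^+ k.+1.
  by rewrite mE NegzE rmorphN mulNr expiN expiMn exprVn.
have sol : solid l j (complex_vec (sph_point a)) =
    (-1) ^+ k.+1 * ((expi a.2)^-1 * (sin a.1)%:C) ^+ k.+1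
      * (nderivn (l + k.+1) (('X^2 - 1) ^+ l)).[(cos a.1)%:C].
  rewrite /solid; have [-> -> ->] := sph_pointE a; have [-> ->] := sph_pointM a.
  rewrite jE2 coef_quad_conj; last by lia.
  rewrite coef_quad_nderiv; last by rewrite -sq; ring.
  by rewrite addnA addnn exprD -mul2n exprM sqrrN expr1n expr1n mul1r mulrA.
have sg : (-1) ^+ (l + j) = (-1) ^+ k.+1 :> R[i].
  by rewrite -signr_odd -[RHS]signr_odd; congr (_ ^+ _); lia.
rewrite sol sg mE ferrers_Negz.
rewrite (@zfact_nat _ (l%:Z - k.+1%:Z) j); last by lia.
rewrite (@zfact_nat _ (l%:Z + k.+1%:Z) (l + k.+1)); last by lia.
have rc (x y : R) : (x * y)%:C = x%:C * y%:C by rewrite rmorphM.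
rewrite [(_ * ferrers_nat _ _ _)%:C]rc nat_case rc.
rewrite fmorph_div rmorphXn rmorphN1 /= !rmorph_nat exprMn.
have f1 := factr_neq0 R[i] l; have f2 := factr_neq0 R[i] (l + k.+1).
have t0 : (2 : R[i]) ^+ l != 0 by rewrite expf_neq0// pnatr_eq0.
set e := (expi a.2)^-1 ^+ _; set s := (_)%:C ^+ k.+1; set D := _.[_].
by field; rewrite f1 f2 t0.
Qed.

Lemma iexprz_neg k : 'i ^ (- k%:Z) = (-1) ^+ k * 'i ^+ k :> R[i].
Proof.
have i0 : 'i != 0 :> R[i] by apply/eqP => /(congr1 (fun w => complex.Im w)) /= /eqP; rewrite
    oner_eq0.
rewrite -exprz_inv -exprnP -exprMn; congr (_ ^+ _).
by apply: (mulIf i0); rewrite mulVf// -mulrA mulii mulN1r opprK.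
Qed.

Lemma d_upE z : [/\ d_up z ord0 0 = 'i * (Num.sqrt (z ^+ 2 - 1))%:C, d_up z ord31 0 = 0 &
   d_up z ord32 0 = z%:C].
Proof. by split; rewrite mxE /tnth. Qed.

Lemma sqr_d_up z : 1 <= z -> (Num.sqrt (z ^+ 2 - 1))%:C ^+ 2 = z%:C ^+ 2 - 1.
Proof.
move=> z1; rewrite -!rmorphXn /= sqr_sqrtr ?rmorphB ?rmorph1//.
by rewrite subr_ge0 exprn_ege1.
Qed.

Lemma sumsq_d_up z : 1 <= z -> \sum_i d_up z i 0 ^+ 2 = 1.
Proof.
move=> z1; rewrite big_ord3; have [-> -> ->] := d_upE z.
by rewrite exprMn [X in X * _]expr2 mulii sqr_d_up//; ring.
Qed.

(** The powers of $i$ come from the first coordinate $i\sqrt{z^2-1}$ of [d_up]; they account for the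
    factor $i^{-m'}$ of the expansion. *)
Lemma legendre_d_up l j z : 1 <= z -> (j <= l.*2)%N ->
  'i ^ (- (j%:Z - l%:Z)) * (legendre l (j%:Z - l%:Z) z)%:C =
  (-1) ^+ (l + j) * (j`!%:R / (2 ^+ l * l`!%:R)) * solid l j (d_up z).
Proof.
move=> z1 jl.
set s := Num.sqrt (z ^+ 2 - 1).
have nat_case k : (legendre_nat l k z)%:C =
    ((l + k)`!%:R / (2 ^+ l * l`!%:R)) *
      (s%:C ^+ k * (nderivn (l + k) (('X^2 - 1) ^+ l)).[z%:C]).
  rewrite /legendre_nat rodriguesE powR_half; last first.
    by rewrite subr_ge0 exprn_ege1.
  rewrite -map_poly_rodrigues horner_nderivC.
  rewrite !rmorphM fmorphV !rmorphM !rmorphXn rmorph1 /= !rmorph_nat -/s.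
  by ring.
have sq : ('i * s%:C) * (- ('i * s%:C)) = z%:C ^+ 2 - 1.
  by rewrite mulrN mulrACA mulii -expr2 sqr_d_up// mulN1r opprK.
have pos k : solid l (l + k) (d_up z) = ('i * s%:C) ^+ k * (nderivn (l + k) (('X^2 - 1) ^+
    l)).[z%:C].
  rewrite /solid; have [-> -> ->] := d_upE z; rewrite mulr0 addr0 subr0.
  by rewrite coef_quad_nderiv.
have [[k [jE ->]]|[k [jE [kl mE]]]] := weight_cases jl.
  rewrite jE pos /= nat_case iexprz_neg.
  rewrite exprMn addnA addnn exprD -mul2n exprM sqrrN expr1n expr1n mul1r.
  by ring.
have jE2 : j = (l.*2 - (l + k.+1))%N by lia.
have neg : solid l j (d_up z) = (-1) ^+ k.+1 * solid l (l + k.+1) (d_up z).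
  rewrite /solid; have [-> -> ->] := d_upE z; rewrite mulr0 addr0 subr0 jE2.
  rewrite coef_quad_conj; last by lia.
  by rewrite addnA addnn exprD -mul2n exprM sqrrN expr1n expr1n mul1r.
have sg : (-1) ^+ (l + j) = (-1) ^+ k.+1 :> R[i].
  by rewrite -signr_odd -[RHS]signr_odd; congr (_ ^+ _); lia.
rewrite neg pos sg mE legendre_Negz NegzE opprK -exprnP.
rewrite (@zfact_nat _ (l%:Z - k.+1%:Z) j); last by lia.
rewrite (@zfact_nat _ (l%:Z + k.+1%:Z) (l + k.+1)); last by lia.
have rc (x y : R) : (x * y)%:C = x%:C * y%:C by rewrite rmorphM.
rewrite [(_ * legendre_nat _ _ _)%:C]rc nat_case fmorph_div /= !rmorph_nat exprMn.
have f1 := factr_neq0 R[i] l; have f2 := factr_neq0 R[i] (l + k.+1).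
have t0 : (2 : R[i]) ^+ l != 0 by rewrite expf_neq0// pnatr_eq0.
have sg2 : (-1) ^+ k.+1 * (-1) ^+ k.+1 = 1 :> R[i].
  by rewrite -exprD addnn -mul2n exprM sqrrN expr1n expr1n.
set e := 'i ^+ _; set u := (_)%:C ^+ k.+1; set D := _.[_].
rewrite [RHS](_ : _ = ((-1) ^+ k.+1 * (-1) ^+ k.+1) * (j`!%:R / (2 ^+ l * l`!%:R)) * (e * u * D)).
  by rewrite sg2; field; rewrite f1 f2 t0.
by ring.
Qed.

End Harmonics.

(** * Collapse of the double sum over the orders *)

Section Bracket.
Variable R : realType.
Implicit Types (x z t : R) (a : R * R) (v : 'cV[R]_3).

Lemma circle_angle (x y : R) : x ^+ 2 + y ^+ 2 = 1 ->
  exists2 t, t \in `[0, 2 * pi[ & cos t = x /\ sin t = y.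
Proof.
move=> xy.
have x1 : -1 <= x <= 1 by apply/andP; split; nra.
have y2 : 1 - x ^+ 2 = y ^+ 2 by lra.
have [y0|y0] := leP 0 y.
  exists (acos x); last first.
    by rewrite acosK ?in_itv// sin_acos// y2 sqrtr_sqr ger0_norm.
  rewrite in_itv/= acos_ge0//= (le_lt_trans (acos_lepi x1))//.
  by rewrite ltr_pMl ?pi_gt0// ltr1n.
(* Strictness gives $\arccos x > 0$, which keeps $2\pi-\arccos x$ below $2\pi$. *)
have x1' : -1 <= x < 1 by case/andP: x1 => -> x1 /=; rewrite lt_neqAle x1 andbT; apply/eqP =>
    xE; nra.
exists (2 * pi - acos x).
  rewrite in_itv/= subr_ge0 ltrBlDr ltrDl acos_gt0// andbT.
  by rewrite (le_trans (acos_lepi x1))// ler_pMl ?pi_gt0// ler1n.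
have -> : 2 * pi - acos x = - acos x + pi *+ 2 by rewrite addrC mulr_natl.
rewrite cosD2pi sinD2pi cosN sinN acosK ?in_itv// sin_acos// y2 sqrtr_sqr ltr0_norm//.
by rewrite opprK.
Qed.

Lemma sph_point_surj v : \sum_i v i 0 ^+ 2 = 1 -> exists a, Theta a /\ v = sph_point a.
Proof.
rewrite big_ord3; set p := v ord0 0; set q := v ord31 0; set r := v ord32 0 => v1.
have r1 : -1 <= r <= 1 by apply/andP; split; nra.
pose s := Num.sqrt (1 - r ^+ 2).
have s2 : s ^+ 2 = p ^+ 2 + q ^+ 2 by rewrite sqr_sqrtr; nra.
have [phi phiI [pE qE]] : exists2 t, t \in `[0, 2 * pi[ & s * cos t = p /\ s * sin t = q.
  have [s0|s0] := eqVneq s 0.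
    exists 0; first by rewrite in_itv/= lexx mulr_gt0 ?pi_gt0.
    by rewrite s0 !mul0r; move: s2; rewrite s0 => s2; split; nra.
  have [|t tI [ct st]] := @circle_angle (p / s) (q / s).
    by rewrite !expr_div_n -mulrDl -s2 divff// expf_neq0.
  by exists t => //; rewrite ct st !(mulrC s) !divfK.
exists (acos r, phi); split.
  split; last exact: phiI.
  by rewrite /= in_itv/= acos_ge0// acos_lepi.
have sE : sin (acos r) = s by rewrite sin_acos.
apply/colP => i; rewrite mxE.
have : i = ord0 \/ i = ord31 \/ i = ord32.
  by case: i => -[|[|[|]]]//= p3; [left|right;left|right;right]; exact: val_inj.
by case=> [->|[->|->]]; rewrite /tnth /= ?sE ?pE ?qE ?acosK ?in_itv.
Qed.

Lemma YsphE l m v : \sum_i v i 0 ^+ 2 = 1 ->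
  exists a, [/\ Theta a, v = sph_point a & Ysph l m v = Ylm l m a.1 a.2].
Proof.
move=> v1; rewrite /Ysph.
have := xgetPex (0, 0) (sph_point_surj v1).
by set a := xget _ _ => -[? ?]; exists a.
Qed.

Definition norm_fact l j : R := Num.sqrt (j`!%:R * (l.*2 - j)`!%:R).

Lemma sqr_norm_fact l j : norm_fact l j ^+ 2 = j`!%:R * (l.*2 - j)`!%:R.
Proof. by rewrite sqr_sqrtr// mulr_ge0. Qed.

Lemma norm_fact_neq0 l j : norm_fact l j != 0.
Proof. by rewrite gt_eqF// sqrtr_gt0 mulr_gt0// ltr0n fact_gt0. Qed.

Definition sph_const l : R := Num.sqrt ((2 * l%:R + 1) / (4 * pi)).

(** The factor $(l+m)!$ turns the quotient of factorials under the root into the product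
    $(l+m)!\,(l-m)!$, symmetric in $\pm m$. *)
Lemma gamma_lmE l j : (j <= l.*2)%N ->
  gamma_lm R l (j%:Z - l%:Z) * j`!%:R = sph_const l * norm_fact l j.
Proof.
move=> jl; rewrite /gamma_lm.
rewrite (@zfact_nat _ (l%:Z - (j%:Z - l%:Z)) (l.*2 - j)); last by lia.
rewrite (@zfact_nat _ (l%:Z + (j%:Z - l%:Z)) j); last by lia.
have p0 : 0 <= (2 * l%:R + 1) / (4 * pi) :> R.
  by rewrite divr_ge0 ?addr_ge0 ?mulr_ge0 ?pi_ge0.
rewrite sqrtrM// -mulrA; congr (_ * _).
rewrite -[j`!%:R in X in _ * X]ger0_norm// -sqrtr_sqr -sqrtrM ?divr_ge0//.
by congr Num.sqrt; field; rewrite factr_neq0.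
Qed.

Lemma Ylm_solid l j a : Theta a -> (j <= l.*2)%N ->
  Ylm l (j%:Z - l%:Z) a.1 a.2 =
  (sph_const l * norm_fact l j)%:C * ((-1) ^+ (l + j) / (2 ^+ l * l`!%:R)) *
    solid l j (complex_vec (sph_point a)).
Proof.
move=> ta jl; rewrite -gamma_lmE// /Ylm cexp_iR -mulrA ferrers_solid//.
rewrite [(_ * j`!%:R)%:C]rmorphM /= rmorph_nat; ring.
Qed.

Lemma gamma_legendre_solid l j z : 1 <= z -> (j <= l.*2)%N ->
  (gamma_lm R l (j%:Z - l%:Z))%:C * 'i ^ (- (j%:Z - l%:Z)) * (legendre l (j%:Z - l%:Z) z)%:C =
  (sph_const l * norm_fact l j)%:C * ((-1) ^+ (l + j) / (2 ^+ l * l`!%:R)) *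
    solid l j (d_up z).
Proof.
move=> z1 jl; rewrite -gamma_lmE// -mulrA legendre_d_up//.
rewrite [(_ * j`!%:R)%:C]rmorphM /= rmorph_nat; ring.
Qed.

(** Puts the conjugate Wigner matrix into the form of the coefficients in [solid_Rot]. *)
Lemma conj_wigner_D l i j th psi : (i <= l.*2)%N -> (j <= l.*2)%N ->
  (wigner_D l (i%:Z - l%:Z) (j%:Z - l%:Z) th psi)^*%C * (norm_fact l j * (-1) ^+ (l + j))%:C =
  expi (- psi) ^+ i / expi (- psi) ^+ l * (expi (- th.2) ^+ j / expi (- th.2) ^+ l) *
    ((-1) ^+ (l + i) * norm_fact l i *
      rot_coef (cos (th.1 / 2)) (sin (th.1 / 2)) l.*2 j i)%:C.
Proof.
move=> il jl.
have cM (u w : R[i]) : (u * w)^*%C = u^*%C * w^*%C by exact: rmorphM.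
have rM (u w : R) : (u * w)%:C = u%:C * w%:C by exact: rmorphM.
rewrite /wigner_D !cexp_iR !cM !conj_expi conjc_real.
rewrite -!mulrN !expiMz rot_coef_wigner// -/(norm_fact l j) -/(norm_fact l i).
set d := wigner_d _ _ _ _; set N := norm_fact l j; set M := norm_fact l i.
have M0 : M != 0 by exact: norm_fact_neq0.
have -> : (-1) ^+ (l + i) * M * ((-1) ^+ (i + j) * (N / M) * d) = d * (N * (-1) ^+ (l + j)).
  have -> : (-1) ^+ (l + j) = (-1) ^+ (l + i) * (-1) ^+ (i + j) :> R.
    by rewrite -exprD -signr_odd -[RHS]signr_odd; congr (_ ^+ _); lia.
  by field.
by rewrite !rM; ring.
Qed.

Lemma sumsq_complex_vec v :
  \sum_i complex_vec v i 0 ^+ 2 = (\sum_i v i 0 ^+ 2)%:C.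
Proof. by rewrite rmorph_sum; apply: eq_bigr => i _; rewrite mxE rmorphXn. Qed.

Lemma modal_bracket l th psi z v : 1 <= z -> \sum_i v i 0 ^+ 2 = 1 ->
  sum_sym l (fun m => sum_sym l (fun m' =>
      (wigner_D l m' m th psi)^*%C * (gamma_lm R l m')%:C * 'i ^ (- m')
        * (legendre l m' z)%:C) * Ysph l m v) =
  ((l.*2.+1)%:R / (4 * pi))%:C *
   (legendre_poly R[i] l).[\sum_i (map_mx (real_complex R) (Rot th psi) *m d_up z) i 0 * (v i
       0)%:C].
Proof.
move=> z1 v1; have [a [ta vE _]] := YsphE l 0 v1.
(* $R^Tv$ is again a real unit vector, hence has angles, and pairs with [d_up] as $v$ pairs with the
   wave direction. *)
pose v' := (Rot th psi)^T *m v.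
have cv' : complex_vec v' = (map_mx (real_complex R) (Rot th psi))^T *m complex_vec v.
  by rewrite /complex_vec /v' map_mxM map_trmx.
have [a' [_ v'E]] : exists a, Theta a /\ v' = sph_point a.
  apply: sph_point_surj; apply: (@complexI R); rewrite -sumsq_complex_vec cv' sumsq_Rot.
  by rewrite sumsq_complex_vec v1.
have dotE : \sum_i (map_mx (real_complex R) (Rot th psi) *m d_up z) i 0 * (v i 0)%:C =
    \sum_i d_up z i 0 * complex_vec (sph_point a') i 0.
  rewrite -v'E cv'.
  transitivity (((d_up z)^T *m ((map_mx (real_complex R) (Rot th psi))^T *m complex_vec v)) 0 0).
    rewrite mulmxA -trmx_mul mxE; apply: eq_bigr => i _.
    by rewrite [_^T _ _]mxE [complex_vec v i 0]mxE.
  by rewrite mxE; apply: eq_bigr => i _; rewrite [_^T 0 i]mxE.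
rewrite dotE.
have dy : d_up z ord31 0 = 0 by have [] := d_upE z.
have f1 := factr_neq0 R[i] l.
have t0 k : (2 : R[i]) ^+ k != 0 by rewrite expf_neq0// pnatr_eq0.
have E4 : 4 = 2 * 2 :> R[i] by rewrite -natrM.
have rM (u w : R) : (u * w)%:C = u%:C * w%:C by exact: rmorphM.
have H := addition_theorem l a' (sumsq_d_up z1) dy.
have c2 : (sph_const l)%:C ^+ 2 = ((l.*2.+1)%:R / (4 * pi))%:C.
  rewrite -rmorphXn /= sqr_sqrtr; last by rewrite divr_ge0 ?addr_ge0 ?mulr_ge0 ?pi_ge0.
  by have -> : (l.*2.+1)%:R = 2 * l%:R + 1 :> R by rewrite -mul2n; ring.
set P := (legendre_poly _ _).[_] in H *.
have {}H : P = (4 ^+ l * l`!%:R ^+ 2)^-1 * \sum_(j < l.*2.+1) j`!%:R * (l.*2 - j)`!%:R *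
     solid l j (complex_vec (sph_point a')) * solid l j (d_up z).
  rewrite -H mulKf// mulf_neq0 ?expf_neq0// E4 mulf_neq0// ?pnatr_eq0//.
rewrite H -c2 !mulr_sumr /sum_sym.
under eq_bigr do rewrite mulr_suml.
rewrite exchange_big; apply: eq_bigr => i _; cbv beta.
have il : (i <= l.*2)%N by rewrite -ltnS.
rewrite -v'E cv' solid_Rot !(mulr_suml, mulr_sumr); apply: eq_bigr => j _.
have jl : (j <= l.*2)%N by rewrite -ltnS.
have [b [tb vb ->]] := YsphE l (j%:Z - l%:Z) v1.
rewrite Ylm_solid// -vb.
have N2 : (norm_fact l i)%:C * (norm_fact l i)%:C = i`!%:R * (l.*2 - i)`!%:R.
  by rewrite -rM -expr2 sqr_norm_fact rM !rmorph_nat.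
have HG := gamma_legendre_solid z1 il.
have HD := conj_wigner_D th psi il jl.
set D := (wigner_D _ _ _ _ _)^*%C in HD *.
set g := (gamma_lm _ _ _)%:C in HG *; set p := 'i ^ _ in HG *; set q := (legendre _ _ _)%:C in
    HG *.
set Sj := solid l j _; set Si := solid l i (d_up z) in HG *.
(* The normalization and sign of $Y_l^m$ are lent to [D], as [conj_wigner_D] requires. *)
transitivity ((D * (norm_fact l j * (-1) ^+ (l + j))%:C) * (g * p * q) *
   ((sph_const l)%:C / (2 ^+ l * l`!%:R) * Sj)).
  rewrite !rM (rmorphXn (real_complex R)) rmorphN1 /=; ring.
rewrite HG HD !rM -N2 E4 exprMn.
have -> : ((-1) ^+ (l + i))%:C = (-1) ^+ (l + i) :> R[i].
  by rewrite rmorphXn rmorphN1.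
have sg : (-1) ^+ (l + i) * (-1) ^+ (l + i) = 1 :> R[i].
  by rewrite -exprD addnn -mul2n exprM sqrrN expr1n expr1n.
set e1 := expi (- psi) ^+ i / _; set e2 := expi (- th.2) ^+ j / _.
set r := (rot_coef _ _ _ _ _)%:C; set N := (norm_fact l i)%:C.
set c := (sph_const l)%:C.
transitivity (((-1) ^+ (l + i) * (-1) ^+ (l + i)) * e1 * e2 * r * N * N * c * c * Si * Sj / (2
    ^+ l * l`!%:R) / (2 ^+ l * l`!%:R)).
  by ring.
rewrite sg; field.
by rewrite f1 t0.
Qed.

End Bracket.

(** * Behaviour at the origin *)

Section AtZero.
Variable R : realType.

(** In the series for $(2l+1)j_l$ the constant term is $1$ if $l = 0$ and $0$ otherwise; the other
    terms are at most $r^n/n!$. *)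
Lemma sph_bessel_pos_near0 l (r : R) : 0 < r ->
  `|sph_bessel_pos l r - (l == 0%N)%:R| <= expR r - 1.
Proof.
move=> r0.
have cE : (series (exp_coeff r) N - 1) @[N --> \oo] --> expR r - 1.
  by apply: cvgB; [exact: is_cvg_series_exp_coeff|exact: cvg_cst].
have cB : `|series (bessel_coef r l) N - (l == 0%N)%:R| @[N --> \oo] -->
    `|(l.*2.+1)%:R * sph_bessel_pos l r - (l == 0%N)%:R|.
  by apply: cvg_norm; apply: cvgB; [exact: cvg_bessel_coef|exact: cvg_cst].
have le1 : `|(l.*2.+1)%:R * sph_bessel_pos l r - (l == 0%N)%:R| <= expR r - 1.
  apply: (ler_cvg_to cB cE); near=> N.
  have [M ->] : exists M, N = M.+1.
    by exists N.-1; rewrite prednK//; near: N; exact: nbhs_infty_gt.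
  have b0 : bessel_coef r l 0 = (l == 0%N)%:R.
    case: l {cE cB} => [|l]; last by rewrite /bessel_coef legendre_coef_out ?mulr0.
    have := sum_legendre_coef R 0; rewrite big_ord1 fact0 invr1 /bessel_coef => ->.
    by rewrite expr0 !mulr1.
  have e0 : exp_coeff r 0 = 1 by rewrite /exp_coeff /= expr0 fact0 divr1.
  rewrite /series /= !big_nat_recl// b0 e0.
  rewrite ![_ + \sum_(_ <= _ < _) _]addrC !addrK (le_trans (ler_norm_sum _ _ _))//.
  by apply: ler_sum => n _; rewrite norm_bessel_coef_le// ltW.
apply: le_trans le1; case: l {cE cB} => [|l]; first by rewrite double0 mul1r.
by rewrite !subr0 [leRHS]normrM ler_peMl// ger0_norm// ler1n.
Unshelve. all: by end_near. Qed.

Lemma norm_expi (t : R) : `|expi t| = 1.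
Proof. by rewrite normc_def /= cos2Dsin2 sqrtr1. Qed.

Lemma horner_bounded (p : {poly R}) (x : R) : `|x| <= 1 ->
  `|p.[x]| <= \sum_(i < size p) `|p`_i|.
Proof.
move=> x1; rewrite horner_coef (le_trans (ler_norm_sum _ _ _))//.
apply: ler_sum => i _; rewrite normrM normrX ler_piMr//.
by rewrite exprn_ile1.
Qed.

Lemma ferrers_bounded l m : exists B : R, forall x, `|x| <= 1 -> `|ferrers l m x| <= B.
Proof.
have natB k : exists B : R, forall x, `|x| <= 1 -> `|ferrers_nat l k x| <= B.
  pose p : {poly R} := nderivn (l + k) (('X^2 - 1) ^+ l).
  exists (`|(-1) ^+ k / (2 ^+ l * l`!%:R)| * (`|(l + k)`!%:R| * \sum_(i < size p) `|p`_i|)).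
  move=> x x1; rewrite /ferrers_nat rodriguesE -mulrA normrM ler_wpM2l//.
  have x2 : 0 <= 1 - x ^+ 2.
    by rewrite subr_ge0 -real_normK ?num_real// exprn_ile1.
  rewrite powR_half// mulrCA !normrM ler_wpM2l//.
  rewrite -[leRHS]mul1r ler_pM//; last exact: horner_bounded.
  rewrite normrX ger0_norm ?sqrtr_ge0// exprn_ile1 ?sqrtr_ge0//.
  by rewrite -[leRHS]sqrtr1 ler_wsqrtr// gerBl sqr_ge0.
case: m => k; first exact: natB.
have [B BP] := natB k.+1.
exists (`|(-1) ^+ k.+1 * (zfact R (l%:Z - k.+1%:Z) / zfact R (l%:Z + k.+1%:Z))| * B).
by move=> x x1; rewrite ferrers_Negz normrM ler_wpM2l// BP.
Qed.

(** As $v \to 0$ the direction $v/|v|$ has no limit; a uniform bound suffices where $j_l \to 0$. *)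
Lemma Ysph_bounded l m : exists B : R, forall v : 'cV[R]_3, `|Ysph l m v| <= B%:C.
Proof.
have [B BP] := ferrers_bounded l m.
exists (`|gamma_lm R l m| * B) => v; rewrite /Ysph; set a := xget _ _.
rewrite /Ylm cexp_iR !normrM norm_expi mulr1 !norm_realC -rmorphM /= lecR.
by rewrite ler_wpM2l// BP// cos_max.
Qed.

Lemma Ysph00 (u v : 'cV[R]_3) : Ysph 0 0 u = Ysph 0 0 v.
Proof.
have H w : Ysph 0 0 w = (gamma_lm R 0 0)%:C.
  rewrite /Ysph /Ylm mul0r (cexp_iR 0) expi0 mulr1 /= /ferrers_nat.
  rewrite rodriguesE expr0 nderivn0 hornerC mul0r powRr0.
  by rewrite !(expr0, fact0, mulr1, invr1).
by rewrite !H.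
Qed.

Lemma enorm_cvg0 : enorm w @[w --> (0 : 'cV[R]_3)^'] --> (0 : R).
Proof.
have FF : Filter (nbhs (0 : 'cV[R]_3)) by exact: nbhs_filter.
have cs : (\sum_i (w i 0 : R) ^+ 2) @[w --> nbhs (0 : 'cV[R]_3)] -->
    \sum_(i < 3) (0 : 'cV[R]_3) i 0 ^+ 2.
  apply: cvg_big => [|i _]; first exact: add_continuous.
  by apply: cvgM; exact: coord_continuous.
have c : enorm w @[w --> nbhs (0 : 'cV[R]_3)] --> Num.sqrt (\sum_(i < 3) (0 : 'cV[R]_3) i 0 ^+ 2).
  by apply: (cvg_comp _ _ cs); exact: sqrt_continuous.
rewrite big1 ?sqrtr0 in c; last by move=> i _; rewrite mxE expr0n.
by apply: cvg_trans c; apply: cvg_app; exact: nbhs_dnbhs.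
Qed.

(** Properness makes limits at the origin unique; a punctured line through it supplies the
    points. *)
Lemma dnbhs0_proper : ProperFilter (0 : 'cV[R]_3)^'.
Proof.
have c : (fun s : R => s *: (const_mx 1 : 'cV[R]_3)) s @[s --> (0 : R)^'] --> (0 : 'cV[R]_3)^'.
  have := @continuous_injective_withinNx R 'cV[R]_3 (fun s => s *: const_mx 1) 0.
  rewrite scale0r; apply; first exact: scalel_continuous.
  move=> s /colP /(_ ord0); rewrite !mxE mulr1 => ->//.
by apply: Build_ProperFilter_ex => A /c /filter_ex [w Aw]; exists w.
Qed.

Lemma enorm_gt0 (w : 'cV[R]_3) : w != 0 -> 0 < enorm w.
Proof.
move=> w0; rewrite sqrtr_gt0 lt_neqAle sumr_ge0 ?andbT; last by move=> i _; exact: sqr_ge0.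
apply: contra w0; rewrite eq_sym psumr_eq0; last by move=> i _; exact: sqr_ge0.
move=> /allP H; apply/eqP/colP => i; rewrite mxE.
by have := H i (mem_index_enum i); rewrite /= sqrf_eq0 => /eqP.
Qed.

(** The vector [v] may be arbitrary: for $l = 0$ the harmonic is constant, and for $l > 0$ the limit
    is $0$. *)
Lemma sph_wave0 (kappa : R) l m (v : 'cV[R]_3) : 0 < kappa -> (l = 0%N -> m = 0) ->
  sph_wave kappa l m 0 = (l == 0%N)%:R * Ysph l m v.
Proof.
move=> k0 lm; rewrite /sph_wave eqxx.
have [B BP] := Ysph_bounded l m.
have PF := dnbhs0_proper.
apply: cvg_lim => //.
apply: (cvg_complex_squeeze (g := fun w : 'cV[R]_3 => (expR (kappa * enorm w) - 1) * B)); last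
    first.
  rewrite -(mul0r B) -(subrr 1); apply: cvgMl; apply: cvgB; last exact: cvg_cst.
  rewrite -expR0 -(mulr0 kappa).
  apply: (@cvg_comp _ _ _ (fun w : 'cV[R]_3 => kappa * enorm w) expR _ (nbhs (kappa * 0))).
    by apply: cvgMr; exact: enorm_cvg0.
  exact: continuous_expR.
near=> w.
have w0 : w != 0 by near: w; exact: nbhs_dnbhs_neq.
have kw : 0 < kappa * enorm w by rewrite mulr_gt0// enorm_gt0.
set Yw := Ysph l m _.
have -> : (l == 0%N)%:R * Ysph l m v = (l == 0%N)%:R * Yw.
  have [l0|l0] := eqVneq l 0%N; last by rewrite !mul0r.
  by rewrite /Yw (lm l0) l0 (Ysph00 v ((enorm w)^-1 *: w)).
rewrite -mulrBl normrM rmorphM ler_pM//.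
  rewrite /sph_bessel gt_eqF// -(rmorph_nat (real_complex R)) -rmorphB norm_realC.
  by rewrite lecR sph_bessel_pos_near0.
exact: BP.
Unshelve. all: by end_near. Qed.

End AtZero.

Theorem theorem2p10 (R : realType) (kappa : R) (x : 'cV[R]_3)
    (th : R * R) (psi zeta : R) :
  0 < kappa -> B1 x -> Ydom (th, psi, zeta) ->
  let u := fun l : nat =>
    'i ^+ l * sum_sym l (fun m : int =>
      sum_sym l (fun m' : int =>
        (wigner_D l m' m th psi)^* * (gamma_lm R l m')%:C * 'i ^ (- m')
          * (legendre l m' (1 + zeta / (2 * kappa)))%:C)
      * sph_wave kappa l m x) in
  cvgn (series u) /\
  EW kappa (th, psi, zeta) x = (4 * pi)%:C * limn (series u).
Proof.
move=> k0 _ yI u.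
have z0 : 0 <= zeta by case: yI => _; rewrite /= in_itv/= andbT.
set z := 1 + zeta / (2 * kappa) in u *.
have z1 : 1 <= z by rewrite lerDl divr_ge0// mulr_ge0// ltW.
suff H : series u @ \oo --> ((4 * pi)%:C)^-1 * EW kappa (th, psi, zeta) x.
  split; first by apply/cvg_ex; eexists; exact: H.
  have p0 : (4 * pi)%:C != 0 :> R[i].
    by rewrite fmorph_eq0 mulf_neq0// ?pnatr_eq0// gt_eqF// pi_gt0.
  by rewrite (cvg_lim _ H)// mulrA divff// mul1r.
pose d : 'cV[R[i]]_3 := map_mx (real_complex R) (Rot th psi) *m d_up z.
pose br l (v : 'cV[R]_3) := sum_sym l (fun m : int => sum_sym l (fun m' : int =>
        (wigner_D l m' m th psi)^* * (gamma_lm R l m')%:C * 'i ^ (- m')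
          * (legendre l m' z)%:C) * Ysph l m v).
have brE l (v : 'cV[R]_3) : \sum_i v i 0 ^+ 2 = 1 -> br l v = ((l.*2.+1)%:R / (4 * pi))%:C *
   (legendre_poly R[i] l).[\sum_i d i 0 * (v i 0)%:C].
  by move=> v1; exact: modal_bracket.
have [x0|x0] := eqVneq x 0.
  (* At the origin any unit vector can stand for the direction; only the term $l = 0$ survives, with
     value $1/(4\pi)$. *)
  pose e : 'cV[R]_3 := \col_i (i == ord0)%:R.
  have e1 : \sum_i e i 0 ^+ 2 = 1.
    rewrite (bigD1 ord0)//= big1 => [|i i0]; first by rewrite mxE eqxx expr1n addr0.
    by rewrite mxE (negPf i0) expr0n.
  have uE l : u l = (l == 0%N)%:R * ((4 * pi)%:C)^-1.
    have -> : u l = 'i ^+ l * ((l == 0%N)%:R * br l e).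
      rewrite /u /br /sum_sym; congr (_ * _); rewrite mulr_sumr; apply: eq_bigr => j _.
      rewrite x0 (@sph_wave0 _ _ _ _ e)//; last first.
        by move=> l0; move: j; rewrite l0 => j; rewrite (ord1 j).
      by rewrite mulrCA.
    case: l => [|l]; last by rewrite !mul0r mulr0.
    by rewrite brE// legendre_poly0 hornerC mulr1 expr0 !mul1r fmorphV.
  have -> : EW kappa (th, psi, zeta) x = 1.
    rewrite /EW big1 ?mulr0; last by move=> i _; rewrite x0 [(0 : 'cV[R]_3) i 0]mxE rmorph0 mulr0.
    by have := cexp_iR (0 : R); rewrite rmorph0 mulr0 expi0.
  rewrite mulr1; apply: cvg_near_cst; near=> N.
  have [M ->] : exists M, N = M.+1.
    by exists N.-1; rewrite prednK//; near: N; exact: nbhs_infty_gt.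
  rewrite /series /= big_nat_recl//= uE eqxx mul1r big1 ?addr0// => i _.
  by rewrite uE mul0r.
pose n := enorm x; have n0 : 0 < n by exact: enorm_gt0.
pose v := n^-1 *: x.
have v1 : \sum_i v i 0 ^+ 2 = 1.
  under eq_bigr do rewrite mxE exprMn.
  rewrite -mulr_sumr -[X in _ * X]sqr_sqrtr; last by apply: sumr_ge0 => i _; exact: sqr_ge0.
  by rewrite -/(enorm x) -/n -exprMn mulVf ?expr1n// gt_eqF.
have rM (s t : R) : (s * t)%:C = s%:C * t%:C by exact: rmorphM.
(* Away from the origin $j_l(r)$ factors out of the sum over $m$, which leaves the bracket at the
   unit vector [v]. *)
pose r := kappa * n; have r0 : 0 < r by rewrite mulr_gt0.
have EWE : EW kappa (th, psi, zeta) x = cexp ('i * r%:C * \sum_i d i 0 * (v i 0)%:C).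
  rewrite /EW /r /dir -/d; congr cexp; rewrite !mulr_sumr; apply: eq_bigr => i _.
  have -> : v i 0 = n^-1 * x i 0 by rewrite mxE.
  rewrite !rM (fmorphV (real_complex R)) /=; field.
  by rewrite fmorph_eq0 gt_eqF.
have uE : u = fun l => ((4 * pi)%:C)^-1 *
   ('i ^+ l * ((l.*2.+1)%:R * sph_bessel_pos l r)%:C * (legendre_poly R[i] l).[\sum_i d i 0 *
       (v i 0)%:C]).
  apply/funext => l.
  have -> : u l = 'i ^+ l * ((sph_bessel l r)%:C * br l v).
    rewrite /u /br /sum_sym; congr (_ * _); rewrite mulr_sumr; apply: eq_bigr => j _.
    by rewrite /sph_wave (negPf x0) mulrCA.
  rewrite brE// /sph_bessel gt_eqF// ![(_ * sph_bessel_pos _ _)%:C]rM [(_ / _)%:C]rM.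
  by rewrite (fmorphV (real_complex R)) /=; ring.
have -> : series u = fun N => ((4 * pi)%:C)^-1 * series (fun l => 'i ^+ l * ((l.*2.+1)%:R *
    sph_bessel_pos l r)%:C * (legendre_poly R[i] l).[\sum_i d i 0 * (v i 0)%:C]) N.
  by apply/funext => N; rewrite uE /series /= mulr_sumr.
rewrite EWE; apply: cvgMr; exact: jacobi_anger.
Unshelve. all: by end_near. Qed.
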